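(* Let $S_g$ be the fundamental group of the closed orientable hyperbolic surface of genus $g\ge 2$. Then for any non-identity element $\gamma\in S_g$ there is an action of $S_g$ on some locally finite tree which is minimal, faithful and such that $\gamma$ acts hyperbolically.
   Context: Trees are simplicial trees with the path metric; actions on trees are by simplicial automorphisms; locally finite means every vertex has finite degree. An automorphism of a tree is elliptic if it fixes a point of the tree and hyperbolic otherwise (it then translates along an axis). An action on a tree is minimal if there is no proper non-empty invariant subtree. *)

(* Defs.v *)
From HB Require Import structures.
From mathcomp Require Import all_boot all_order all_algebra.
From mathcomp Require Import boolp reals.

Set Implicit Arguments.
Unset Strict Implicit.
Unset Printing Implicit Defensive.

Import Order.TTheory GRing.Theory Num.Theory.

(* The group < X | R > given by a presentation, as the quotient of the words  *)
(* in X and its formal inverses. The letter (x, false) is x, and (x, true) is *)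
(* its inverse.                                                               *)
Section Presentation.

Variables (X : choiceType) (R : seq (X * bool) -> Prop).

Definition word_inv (w : seq (X * bool)) : seq (X * bool) :=
  rev [seq (l.1, ~~ l.2) | l <- w].

Inductive word_eq : seq (X * bool) -> seq (X * bool) -> Prop :=
| word_eq_refl w : word_eq w w
| word_eq_sym u v : word_eq u v -> word_eq v u
| word_eq_trans u v w : word_eq u v -> word_eq v w -> word_eq u w
| word_eq_cat u u' v v' :
    word_eq u u' -> word_eq v v' -> word_eq (u ++ v) (u' ++ v')
| word_eq_cancel x b : word_eq [:: (x, b); (x, ~~ b)] [::]
| word_eq_rel r : R r -> word_eq r [::].

Definition word_eqb : rel (seq (X * bool)) := fun u v => `[< word_eq u v >].

Lemma word_eqb_equiv : equiv_class_of word_eqb.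
Proof.
split=> [w|u v|v u w].
- exact/asboolP/word_eq_refl.
- by apply/asboolP/asboolP; apply: word_eq_sym.
- by move=> /asboolP uv /asboolP vw; apply/asboolP/(word_eq_trans uv vw).
Qed.

Canonical word_eqb_equiv_rel := EquivRelPack word_eqb_equiv.

Definition presented_group : Type := {eq_quot word_eqb}%qT.

HB.instance Definition _ := Choice.on presented_group.
HB.instance Definition _ := EqQuotient.on presented_group.

Local Open Scope quotient_scope.

Definition word_class (w : seq (X * bool)) : presented_group :=
  \pi_presented_group w.

Lemma word_classP u v : word_class u = word_class v <-> word_eq u v.
Proof.
rewrite /word_class; split=> [/eqmodP/asboolP//|uv].
exact/eqmodP/asboolP.
Qed.

Lemma word_class_repr (x : presented_group) : word_class (repr x) = x.
Proof. exact: reprK. Qed.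

Lemma repr_word_class w : word_eq (repr (word_class w)) w.
Proof. by apply/word_classP; rewrite word_class_repr. Qed.

Lemma word_invK : involutive word_inv.
Proof.
move=> w; rewrite /word_inv map_rev revK -map_comp -[RHS]map_id.
by apply: eq_map => -[x b] /=; rewrite negbK.
Qed.

Lemma word_inv_cat u v : word_inv (u ++ v) = word_inv v ++ word_inv u.
Proof. by rewrite /word_inv map_cat rev_cat. Qed.

Lemma word_mulV w : word_eq (w ++ word_inv w) [::].
Proof.
elim: w => [|[x b] w IHw]; first exact: word_eq_refl.
rewrite -cat1s word_inv_cat -catA (catA w).
apply: word_eq_trans (word_eq_cancel x b).
apply: (@word_eq_cat [:: (x, b)] [:: (x, b)] _ [:: (x, ~~ b)]).
  exact: word_eq_refl.
by apply: (@word_eq_cat _ [::]) => //; apply: word_eq_refl.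
Qed.

Lemma word_Vmul w : word_eq (word_inv w ++ w) [::].
Proof. by rewrite -{2}(word_invK w); apply: word_mulV. Qed.

Lemma word_eq_inv u v : word_eq u v -> word_eq (word_inv u) (word_inv v).
Proof.
move=> uv; have rfl w := word_eq_refl w.
apply: (@word_eq_trans _ (word_inv u ++ (v ++ word_inv v))).
  rewrite -{1}[word_inv u]cats0; apply: word_eq_cat => //.
  exact/word_eq_sym/word_mulV.
rewrite catA; apply: (@word_eq_cat _ [::]) => //.
apply: word_eq_trans (word_Vmul u).
by apply: word_eq_cat => //; apply: word_eq_sym.
Qed.

Definition pres_one : presented_group := word_class [::].
Definition pres_mul (x y : presented_group) : presented_group :=
  word_class (repr x ++ repr y).
Definition pres_inv (x : presented_group) : presented_group :=
  word_class (word_inv (repr x)).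

Lemma pres_mulE u v :
  pres_mul (word_class u) (word_class v) = word_class (u ++ v).
Proof. by apply/word_classP/word_eq_cat; apply: repr_word_class. Qed.

Lemma pres_invE u : pres_inv (word_class u) = word_class (word_inv u).
Proof. by apply/word_classP/word_eq_inv; apply: repr_word_class. Qed.

Lemma pres_mulA : associative pres_mul.
Proof.
move=> x y z; rewrite -(word_class_repr x) -(word_class_repr y).
by rewrite -(word_class_repr z) !pres_mulE catA.
Qed.

Lemma pres_mul1 : left_id pres_one pres_mul.
Proof. by move=> x; rewrite -(word_class_repr x) pres_mulE. Qed.

Lemma pres_mulr1 : right_id pres_one pres_mul.
Proof. by move=> x; rewrite -(word_class_repr x) pres_mulE cats0. Qed.

Lemma pres_mulVx : left_inverse pres_one pres_inv pres_mul.
Proof.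
move=> x; rewrite -(word_class_repr x) pres_invE pres_mulE.
exact/word_classP/word_Vmul.
Qed.

Lemma pres_mulxV : right_inverse pres_one pres_inv pres_mul.
Proof.
move=> x; rewrite -(word_class_repr x) pres_invE pres_mulE.
exact/word_classP/word_mulV.
Qed.

HB.instance Definition _ := isGroup.Build presented_group
  pres_mulA pres_mul1 pres_mulr1 pres_mulVx pres_mulxV.

End Presentation.

(* The closed orientable surface of genus g is a 4g-gon with its sides        *)
(* identified along the word [a_1, b_1] ... [a_g, b_g]. This is a cell        *)
(* complex with one vertex, 2g oriented edges a_i = inl i and b_i = inr i,    *)
(* and one face, so its fundamental group consists of the edge loops (words   *)
(* in the a_i, b_i and their inverses) up to backtracking and pushing across  *)
(* the face.                                                                  *)
Definition surface_word (g : nat) : seq (('I_g + 'I_g) * bool) :=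
  flatten [seq [:: (inl i, false); (inr i, false); (inl i, true); (inr i, true)]
          | i <- enum 'I_g].

Definition surface_group (g : nat) : groupType :=
  @presented_group ('I_g + 'I_g)%type (fun w => w = surface_word g).

(* A tree is given by its vertices and their adjacency relation. A simple     *)
(* closed path of size 2 is just an edge traversed back and forth.            *)
Record tree := Tree {
  vertex :> choiceType;
  adj : rel vertex;
  adj_sym : symmetric adj;
  adj_irr : irreflexive adj;
  tree_inhabited : inhabited vertex;
  tree_connected : forall x y, exists2 p, path adj x p & last x p = y;
  tree_acyclic : forall c, ucycle adj c -> size c <= 2
}.

Definition locally_finite (T : tree) : Prop :=
  forall x : T, exists s : seq T, forall y, adj x y -> y \in s.

Record tree_action (G : groupType) (T : tree) := TreeAction {
  act :> G -> T -> T;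
  act1 : forall x, act 1%g x = x;
  actM : forall a b x, act (a * b)%g x = act a (act b x);
  act_adj : forall a x y, adj (act a x) (act a y) = adj x y
}.

Definition faithful_action (G : groupType) (T : tree) (rho : tree_action G T)
    : Prop :=
  forall a, (forall x, rho a x = x) -> a = 1%g.

(* A subtree of T contains every edge of T between two of its vertices, so it *)
(* is determined by its set of vertices.                                      *)
Definition subtree (T : tree) (S : T -> Prop) : Prop :=
  forall x y, S x -> S y ->
    exists p, [/\ path (@adj T) x p, last x p = y & forall z, z \in p -> S z].

Definition minimal_action (G : groupType) (T : tree) (rho : tree_action G T)
    : Prop :=
  forall S : T -> Prop, subtree S -> (exists x, S x) ->
    (forall a x, S x -> S (rho a x)) -> forall x, S x.

Section Points.

Local Open Scope ring_scope.

(* Points of the geometric realization of T, in barycentric coordinates: the  *)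
(* vertices (x = y), and the points dividing an edge {x, y} in the ratio      *)
(* t : 1 - t.                                                                 *)
Definition tree_point (R : realType) (T : tree) (p : T -> R) : Prop :=
  exists x y t, [/\ x = y \/ adj x y, 0 <= t <= 1 &
    forall v, p v = (1 - t) * (v == x)%:R + t * (v == y)%:R].

Definition point_act (R : realType) (G : groupType) (T : tree)
    (rho : tree_action G T) (a : G) (p : T -> R) : T -> R :=
  fun v => p (rho (a^-1)%g v).

Definition elliptic (R : realType) (G : groupType) (T : tree)
    (rho : tree_action G T) (a : G) : Prop :=
  exists2 p : T -> R, tree_point p & point_act rho a p =1 p.

Definition hyperbolic (R : realType) (G : groupType) (T : tree)
    (rho : tree_action G T) (a : G) : Prop :=
  ~ elliptic R rho a.

End Points.

(* Main.v *)
Require Import Defs.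
From mathcomp Require Import all_boot all_order all_algebra.
From mathcomp Require Import boolp reals.
From HB Require Import structures.
From mathcomp Require Import ring zify.

Set Implicit Arguments.
Unset Strict Implicit.
Unset Printing Implicit Defensive.

Import Order.TTheory GRing.Theory Num.Theory.

Local Open Scope ring_scope.

(**
The group S_g is the fundamental group of a cyclic cover of degree g - 1 of the
genus 2 surface, and S_2 is the double F *_c F' of the free group F on a, b
along c = [a, b]. So it suffices to find suitable actions of the double.

Over the ring O = F_3[[t]] there is an explicit Schottky pair a, b acting simply
transitively on the vertices of the tree of PGL_2 of the fraction field of O:
the residues of a, b and of their inverses have rank one, with images the four
points of P^1(F_3). Hence every nontrivial u in F is hyperbolic, in the sense
that 2 v(tr u) < v(det u). The pair is chosen so that c is diag(1, t^4) up to
scalars. If u fixes an end of the axis of c, i.e. is triangular, then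
u is a power of c; so both off-diagonal entries of u are nonzero otherwise.

As z = diag(1, t^(4n) s) commutes with c, letting F' act through z u z^-1 gives
an action of the double. An element of the double is conjugate to 1, or into a
factor, or to a product u_1 v_1 ... u_k v_k with u_i in F, v_i in F' outside <c>.
In the last case the matrix P = prod u_i z v_i z^-1 is, up to scalars, polynomial
in the lower right entry of z, and at 0 its first column vanishes while its lower
right entry is the product of the off-diagonal entries (u_i)_21 (v_i)_12. So P is
hyperbolic as soon as n is large, and it is not scalar unless s is a root of a
certain nonzero polynomial; there are countably many of these and uncountably
many s. Taking n large for the given gamma, and s = 1 mod t outside the countable
set of all roots, we get a faithful action for which gamma is hyperbolic.

Since s = 1 mod t, the action is close to the one that folds the double onto F:
the element c^n a^-1 c^-n a' fixes the vertex c^n O^2 and maps to a generator of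
the deck group of the cyclic cover. So S_g is transitive on vertices, like the
double; this gives minimality.
*)

(** * Power series *)

Section PowerSeries.

Variable F : fieldType.

Record pseries := PSeries { coefs : nat -> F }.

HB.instance Definition _ := gen_eqMixin pseries.
HB.instance Definition _ := gen_choiceMixin pseries.

Implicit Types x y z : pseries.

Lemma pseriesP x y : coefs x =1 coefs y -> x = y.
Proof. by case: x y => [f] [g] /= /funext ->. Qed.

Definition ps_const (a : F) := PSeries (fun n => a *+ (n == 0)%N).
Definition ps_add x y := PSeries (fun n => coefs x n + coefs y n).
Definition ps_opp x := PSeries (fun n => - coefs x n).
Definition ps_mul x y :=
  PSeries (fun n => \sum_(i < n.+1) coefs x i * coefs y (n - i)%N).

Lemma ps_addA : associative ps_add.
Proof. by move=> x y z; apply: pseriesP => n /=; rewrite addrA. Qed.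

Lemma ps_addC : commutative ps_add.
Proof. by move=> x y; apply: pseriesP => n /=; rewrite addrC. Qed.

Lemma ps_add0 : left_id (ps_const 0) ps_add.
Proof. by move=> x; apply: pseriesP => n /=; rewrite mul0rn add0r. Qed.

Lemma ps_addN : left_inverse (ps_const 0) ps_opp ps_add.
Proof. by move=> x; apply: pseriesP => n /=; rewrite mul0rn addNr. Qed.

HB.instance Definition _ :=
  GRing.isZmodule.Build pseries ps_addA ps_addC ps_add0 ps_addN.

Definition ps_trunc n x : {poly F} := \poly_(i < n) coefs x i.

(** Truncation turns products of series into products of polynomials, from which commutativity and
    associativity of [ps_mul] are inherited. *)
Lemma coef_ps_mul n N x y : (n < N)%N ->
  coefs (ps_mul x y) n = (ps_trunc N x * ps_trunc N y)`_n.
Proof.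
move=> nN; rewrite coefM /=; apply: eq_bigr => i _.
by rewrite !coef_poly !(leq_ltn_trans _ nN) ?leq_subr // -ltnS.
Qed.

Lemma coefM_trunc (p q r : {poly F}) n : (forall i, (i <= n)%N -> p`_i = q`_i) ->
  (p * r)`_n = (q * r)`_n.
Proof.
by move=> pq; rewrite !coefM; apply: eq_bigr => i _; rewrite pq // -ltnS.
Qed.

Lemma ps_mulC : commutative ps_mul.
Proof.
by move=> x y; apply: pseriesP => n; rewrite !(@coef_ps_mul n n.+1) // mulrC.
Qed.

Lemma ps_mulA : associative ps_mul.
Proof.
move=> x y z; apply: pseriesP => n; rewrite !(@coef_ps_mul n n.+1) //.
have tr u v i : (i <= n)%N ->
    (ps_trunc n.+1 (ps_mul u v))`_i = (ps_trunc n.+1 u * ps_trunc n.+1 v)`_i.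
  by move=> le_in; rewrite coef_poly ltnS le_in (@coef_ps_mul i n.+1).
rewrite [RHS](coefM_trunc _ (tr x y)) mulrC (coefM_trunc _ (tr y z)).
by rewrite mulrC mulrA.
Qed.

Lemma ps_mul1 : left_id (ps_const 1) ps_mul.
Proof.
move=> x; apply: pseriesP => n /=; rewrite big_ord_recl /= mul1r subn0 big1 ?addr0 //.
by move=> i _; rewrite mul0r.
Qed.

Lemma ps_mulDl : left_distributive ps_mul ps_add.
Proof.
move=> x y z; apply: pseriesP => n /=; rewrite -big_split; apply: eq_bigr => i _.
by rewrite mulrDl.
Qed.

Lemma ps_one_neq0 : ps_const 1 != 0.
Proof. by apply/eqP => /(congr1 (fun x => coefs x 0))/eqP; rewrite /= oner_eq0. Qed.

HB.instance Definition _ := GRing.Zmodule_isComNzRing.Build pseries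
  ps_mulA ps_mulC ps_mul1 ps_mulDl ps_one_neq0.

Definition ps_unit : pred pseries := fun x => `[< exists y, y * x = 1 >].

Definition ps_inv x : pseries :=
  if pselect (exists y, y * x = 1) is left xP then sval (cid xP) else x.

Lemma ps_mulVx : {in ps_unit, left_inverse 1 ps_inv *%R}.
Proof.
by move=> x /asboolP xP; rewrite /ps_inv; case: pselect => // ex; case: cid.
Qed.

Lemma ps_unitP x y : y * x = 1 -> ps_unit x.
Proof. by move=> yx; apply/asboolP; exists y. Qed.

Lemma ps_inv_out : {in [predC ps_unit], ps_inv =1 id}.
Proof. by move=> x /asboolPn xP; rewrite /ps_inv; case: pselect. Qed.

HB.instance Definition _ := GRing.ComNzRing_hasMulInverse.Build pseries
  ps_mulVx ps_unitP ps_inv_out.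

Lemma ps_nz_coef x : x != 0 -> exists n, coefs x n != 0.
Proof.
move=> /eqP x0; apply: contrapT => H; apply: x0; apply: pseriesP => n.
by rewrite [RHS]mul0rn; apply/eqP/negPn/negP => xn; apply: H; exists n.
Qed.

(** The order of vanishing at t = 0, with default value 0 for the zero series. *)
Definition ps_val x : nat :=
  if pselect (exists n, coefs x n != 0) is left xP then ex_minn xP else 0.

Lemma ps_valP x : x != 0 ->
  coefs x (ps_val x) != 0 /\ forall i, (i < ps_val x)%N -> coefs x i = 0.
Proof.
move=> /ps_nz_coef ex; rewrite /ps_val; case: pselect => // {}ex.
case: ex_minnP => n xn min_n; split=> // i i_n; apply/eqP; case: eqP => // /eqP.
by move/min_n; rewrite leqNgt i_n.
Qed.

Lemma ps_val_eq x n : coefs x n != 0 -> (forall i, (i < n)%N -> coefs x i = 0) ->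
  ps_val x = n.
Proof.
move=> xn xi; have x0: x != 0.
  by apply: contraNneq xn => ->; rewrite [coefs 0 n]mul0rn.
have [xv xj] := ps_valP x0.
apply/eqP; rewrite eqn_leq; apply/andP; split.
  by rewrite leqNgt; apply/negP => /xj/eqP; apply/negP.
by rewrite leqNgt; apply/negP => /xi/eqP; apply/negP.
Qed.

Lemma coef_mul_val x y : x != 0 -> y != 0 ->
  coefs (x * y) (ps_val x + ps_val y) = coefs x (ps_val x) * coefs y (ps_val y).
Proof.
move=> /ps_valP[_ xi] /ps_valP[_ yi].
have lt_v : (ps_val x < (ps_val x + ps_val y).+1)%N by rewrite ltnS leq_addr.
rewrite /= (bigD1 (Ordinal lt_v)) //= addKn big1 ?addr0 // => i.
rewrite -val_eqE /= neq_ltn => /orP[/xi->|vi]; first by rewrite mul0r.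
by rewrite yi ?mulr0 //; have := ltn_ord i; lia.
Qed.

Lemma coef_mul_lt_val x y i : x != 0 -> y != 0 -> (i < ps_val x + ps_val y)%N ->
  coefs (x * y) i = 0.
Proof.
move=> /ps_valP[_ xi] /ps_valP[_ yi] i_lt; rewrite /= big1 // => j _.
have [/xi->|vj] := ltnP j (ps_val x); first by rewrite mul0r.
by rewrite yi ?mulr0 //; have := ltn_ord j; lia.
Qed.

Lemma ps_idomain x y : x * y = 0 -> (x == 0) || (y == 0).
Proof.
move=> xy; apply/norP => -[x0 y0].
have := coef_mul_val x0 y0; rewrite xy [LHS]mul0rn => /esym/eqP.
by rewrite mulf_eq0 (negPf (ps_valP x0).1) (negPf (ps_valP y0).1).
Qed.

HB.instance Definition _ :=
  GRing.ComUnitRing_isIntegral.Build pseries ps_idomain.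

Lemma ps_valM x y : x != 0 -> y != 0 -> ps_val (x * y) = (ps_val x + ps_val y)%N.
Proof.
move=> x0 y0; apply: ps_val_eq => [|i]; last exact: coef_mul_lt_val.
by rewrite coef_mul_val // mulf_neq0 // (ps_valP _).1.
Qed.

Definition ps_shift n x := PSeries (fun i => coefs x (n + i)).

Definition ps_t : pseries := PSeries (fun n => (n == 1)%:R).

Lemma coef_tM x i : coefs (ps_t * x) i = if i is j.+1 then coefs x j else 0.
Proof.
case: i => [|i]; first by rewrite /= big_ord1 mul0r.
rewrite /= big_ord_recl /= mul0r add0r big_ord_recl /= mul1r subSS subn0.
by rewrite big1 ?addr0 // => j _; rewrite mul0r.
Qed.

Lemma coef_tnM n x i :
  coefs (ps_t ^+ n * x) i = if (i < n)%N then 0 else coefs x (i - n).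
Proof.
elim: n i => [|n IHn] i; first by rewrite expr0 mul1r subn0.
by rewrite exprS -mulrA coef_tM; case: i => [|i] //; rewrite IHn ltnS subSS.
Qed.

Lemma ps_shiftE n x : (forall i, (i < n)%N -> coefs x i = 0) ->
  x = ps_t ^+ n * ps_shift n x.
Proof.
move=> xi; apply: pseriesP => i; rewrite coef_tnM.
by case: ltnP => [/xi//|ni]; rewrite /= subnKC.
Qed.

Definition ps_res x : F := coefs x 0.

Lemma ps_res_is_zmod : zmod_morphism ps_res.
Proof. by []. Qed.

Lemma ps_res_is_monoid : monoid_morphism ps_res.
Proof. by split=> [//|x y]; rewrite /ps_res /= big_ord1. Qed.

HB.instance Definition _ :=
  GRing.isZmodMorphism.Build pseries F ps_res ps_res_is_zmod.
HB.instance Definition _ :=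
  GRing.isMonoidMorphism.Build pseries F ps_res ps_res_is_monoid.

Lemma ps_res_t : ps_res ps_t = 0. Proof. by []. Qed.

Lemma ps_t_neq0 : ps_t != 0.
Proof. by apply/eqP => /(congr1 (fun x => coefs x 1))/eqP; rewrite /= oner_eq0. Qed.

Lemma ps_res_val x : ps_res x != 0 -> ps_val x = 0%N.
Proof. by move=> rx; apply: ps_val_eq. Qed.

Lemma ps_val_t : ps_val ps_t = 1%N.
Proof. by apply: ps_val_eq => [|[]//]; rewrite /= oner_eq0. Qed.

Lemma ps_valX n x : x != 0 -> ps_val (x ^+ n) = (n * ps_val x)%N.
Proof.
move=> x0; elim: n => [|n IHn]; last by rewrite exprS ps_valM ?expf_neq0 // IHn.
by rewrite expr0 ps_res_val // rmorph1 oner_eq0.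
Qed.

Lemma ps_val_dvd n x y : x != 0 -> x = ps_t ^+ n * y -> (n <= ps_val x)%N.
Proof.
move=> x0 xE; have y0: y != 0 by apply: contraNneq x0 => y0; rewrite xE y0 mulr0.
by rewrite xE ps_valM ?expf_neq0 ?ps_t_neq0 // ps_valX ?ps_t_neq0 // ps_val_t; lia.
Qed.

Lemma ps_val_split x : x != 0 ->
  exists2 y, ps_res y != 0 & x = ps_t ^+ ps_val x * y.
Proof.
move=> /ps_valP[xv xi]; exists (ps_shift (ps_val x) x); last exact: ps_shiftE.
by rewrite /ps_res /= addn0.
Qed.

Lemma ps_val_res x : x != 0 -> ps_res x = 0 -> (0 < ps_val x)%N.
Proof.
move=> x0 rx; rewrite lt0n; apply/eqP => v0; have [] := ps_valP x0.
by rewrite v0 -/(ps_res x) rx eqxx.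
Qed.

End PowerSeries.

Arguments ps_res : simpl never.

(** * Two by two matrices *)

Section Matrices.

Variable R : comNzRingType.

(** Entries row by row; on plain tuples matrix identities split into entries that [ring] settles. *)
Definition mat2 : Type := (R * R * R * R)%type.

Implicit Types M N U : mat2.

Definition mmul M N : mat2 :=
  let: (a, b, c, d) := M in let: (e, f, g, h) := N in
  (a * e + b * g, a * f + b * h, c * e + d * g, c * f + d * h).
Definition m1 : mat2 := (1, 0, 0, 1).
Definition mscale (k : R) M : mat2 :=
  let: (a, b, c, d) := M in (k * a, k * b, k * c, k * d).
Definition madj M : mat2 := let: (a, b, c, d) := M in (d, - b, - c, a).
Definition mdet M : R := let: (a, b, c, d) := M in a * d - b * c.
Definition mtr M : R := let: (a, b, c, d) := M in a + d.
Definition mdiag (x y : R) : mat2 := (x, 0, 0, y).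

Lemma mmulA : associative mmul.
Proof. by move=> [[[a b] c] d] [[[e f] g] h] [[[i j] k] l]; congr (_, _, _, _); ring. Qed.

Lemma mmul1 : left_id m1 mmul.
Proof. by move=> [[[a b] c] d]; congr (_, _, _, _); ring. Qed.

Lemma mmulr1 : right_id m1 mmul.
Proof. by move=> [[[a b] c] d]; congr (_, _, _, _); ring. Qed.

Lemma mscaleA k l M : mscale k (mscale l M) = mscale (k * l) M.
Proof. by move: M => [[[a b] c] d]; congr (_, _, _, _); ring. Qed.

Lemma mscale1 M : mscale 1 M = M.
Proof. by move: M => [[[a b] c] d]; congr (_, _, _, _); ring. Qed.

Lemma mscalel k M N : mmul (mscale k M) N = mscale k (mmul M N).
Proof. by move: M N => [[[a b] c] d] [[[e f] g] h]; congr (_, _, _, _); ring. Qed.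

Lemma mscaler k M N : mmul M (mscale k N) = mscale k (mmul M N).
Proof. by move: M N => [[[a b] c] d] [[[e f] g] h]; congr (_, _, _, _); ring. Qed.

Lemma mmul_adj M : mmul M (madj M) = mscale (mdet M) m1.
Proof. by move: M => [[[a b] c] d]; congr (_, _, _, _); rewrite /=; ring. Qed.

Lemma madj_mul M : mmul (madj M) M = mscale (mdet M) m1.
Proof. by move: M => [[[a b] c] d]; congr (_, _, _, _); rewrite /=; ring. Qed.

Lemma madjM M N : madj (mmul M N) = mmul (madj N) (madj M).
Proof. by move: M N => [[[a b] c] d] [[[e f] g] h]; congr (_, _, _, _); ring. Qed.

Lemma madjK : involutive madj.
Proof. by move=> [[[a b] c] d]; congr (_, _, _, _); ring. Qed.

Lemma madj_scale k M : madj (mscale k M) = mscale k (madj M).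
Proof. by move: M => [[[a b] c] d]; congr (_, _, _, _); ring. Qed.

Lemma madj1 : madj m1 = m1.
Proof. by congr (_, _, _, _); ring. Qed.

Lemma mdetM M N : mdet (mmul M N) = mdet M * mdet N.
Proof. by move: M N => [[[a b] c] d] [[[e f] g] h] /=; ring. Qed.

Lemma mdet_adj M : mdet (madj M) = mdet M.
Proof. by move: M => [[[a b] c] d] /=; ring. Qed.

Lemma mdet_scale k M : mdet (mscale k M) = k ^+ 2 * mdet M.
Proof. by move: M => [[[a b] c] d] /=; ring. Qed.

Lemma mdet1 : mdet m1 = 1.
Proof. by rewrite /=; ring. Qed.

Lemma mtr_scale k M : mtr (mscale k M) = k * mtr M.
Proof. by move: M => [[[a b] c] d] /=; ring. Qed.

Lemma mtr_conj M N : mtr (mmul (mmul M N) (madj M)) = mdet M * mtr N.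
Proof. by move: M N => [[[a b] c] d] [[[e f] g] h] /=; ring. Qed.

Lemma mtr_sqr M : mtr (mmul M M) = mtr M ^+ 2 - 2%:R * mdet M.
Proof. by move: M => [[[a b] c] d] /=; ring. Qed.

Lemma madj_diag x y : madj (mdiag x y) = mdiag y x.
Proof. by congr (_, _, _, _); ring. Qed.

Lemma mdet_diag x y : mdet (mdiag x y) = x * y.
Proof. by rewrite /=; ring. Qed.

Lemma mmul_diag x y x' y' : mmul (mdiag x y) (mdiag x' y') = mdiag (x * x') (y * y').
Proof. by congr (_, _, _, _); ring. Qed.

Lemma mscale_diag k x y : mscale k (mdiag x y) = mdiag (k * x) (k * y).
Proof. by congr (_, _, _, _); ring. Qed.

End Matrices.

Arguments mdiag : simpl never.

Arguments m1 : simpl never.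
Arguments mmul R !M !N /.
Arguments mscale R k !M /.
Arguments madj R !M /.
Arguments mdet R !M /.
Arguments mtr R !M /.

Definition mmap (R S : Type) (f : R -> S) (M : R * R * R * R) : S * S * S * S :=
  let: (a, b, c, d) := M in (f a, f b, f c, f d).

Section MapMatrices.

Variables (R S : comNzRingType) (f : {rmorphism R -> S}).

Lemma mmap_mul (M N : mat2 R) : mmap f (mmul M N) = mmul (mmap f M) (mmap f N).
Proof.
by move: M N => [[[a b] c] d] [[[e f'] g] h]; rewrite /= !rmorphD !rmorphM.
Qed.

Lemma mmap_scale k (M : mat2 R) : mmap f (mscale k M) = mscale (f k) (mmap f M).
Proof. by move: M => [[[a b] c] d]; rewrite /= !rmorphM. Qed.

Lemma mmap_adj (M : mat2 R) : mmap f (madj M) = madj (mmap f M).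
Proof. by move: M => [[[a b] c] d]; rewrite /= !rmorphN. Qed.

Lemma mmap_det (M : mat2 R) : mdet (mmap f M) = f (mdet M).
Proof. by move: M => [[[a b] c] d]; rewrite /= rmorphB !rmorphM. Qed.

Lemma mmap_tr (M : mat2 R) : mtr (mmap f M) = f (mtr M).
Proof. by move: M => [[[a b] c] d]; rewrite /= rmorphD. Qed.

Lemma mmap1 : mmap f (m1 R) = m1 S.
Proof. by rewrite /m1 /= !rmorph1 !rmorph0. Qed.

End MapMatrices.

(** * Matrices over a domain up to scalars *)

Section Domain.

Variable D : idomainType.

Implicit Types (M N : mat2 D).

Definition m0 : mat2 D := (0, 0, 0, 0).

Lemma mscale_inj k M N : k != 0 -> mscale k M = mscale k N -> M = N.
Proof.
move: M N => [[[a b] c] d] [[[e f] g] h] k0 [] /=.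
by do 4! move/(mulfI k0)->.
Qed.

(** Equality in PGL_2 of the fraction field, expressed without fractions; for nonzero determinant
    [madj] is then the inverse. *)
Definition mprop M N := exists k l, [/\ k != 0, l != 0 & mscale k M = mscale l N].

Lemma mprop_refl M : mprop M M.
Proof. by exists 1, 1; rewrite oner_eq0. Qed.

Lemma mprop_sym M N : mprop M N -> mprop N M.
Proof. by case=> k [l [k0 l0 kl]]; exists l, k. Qed.

Lemma mprop_trans N M P : mprop M N -> mprop N P -> mprop M P.
Proof.
case=> k [l [k0 l0 kl]] [k' [l' [k0' l0' kl']]].
exists (k' * k), (l * l'); rewrite !mulf_neq0 //; split=> //.
by rewrite -mscaleA kl -mscaleA -kl' !mscaleA mulrC.
Qed.

Lemma mprop_mul M N M' N' : mprop M N -> mprop M' N' -> mprop (mmul M M') (mmul N N').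
Proof.
case=> k [l [k0 l0 kl]] [k' [l' [k0' l0' kl']]].
exists (k * k'), (l * l'); rewrite !mulf_neq0 //; split=> //.
by rewrite -mscaleA -mscaler -mscalel kl kl' mscaler mscalel mscaleA mulrC.
Qed.

Lemma mprop_adj M N : mprop M N -> mprop (madj M) (madj N).
Proof.
by case=> k [l [k0 l0 kl]]; exists k, l; rewrite -!madj_scale kl.
Qed.

Lemma mprop_scale k M : k != 0 -> mprop (mscale k M) M.
Proof. by move=> k0; exists 1, k; rewrite oner_eq0 mscale1. Qed.

Lemma mprop_det M N : mprop M N -> (mdet M != 0) = (mdet N != 0).
Proof.
case=> k [l [k0 l0 /(congr1 (@mdet D))]]; rewrite !mdet_scale => e.
have: (k ^+ 2 * mdet M != 0) = (l ^+ 2 * mdet N != 0) by rewrite e.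
by rewrite !mulf_eq0 (negPf k0) (negPf l0).
Qed.

Definition mscalar M := let: (a, b, c, d) := M in [/\ b = 0, c = 0 & a = d].

Lemma mscalar_prop M N : mprop M N -> mscalar M -> mscalar N.
Proof.
move: M N => [[[a b] c] d] [[[e f] g] h] [k [l [k0 l0]]] /= [] ae bf cg dh.
case=> b0 c0 ad; subst b c d; move: bf cg; rewrite mulr0 => /esym/eqP.
rewrite mulf_eq0 (negPf l0) => /eqP -> /esym/eqP.
rewrite mulf_eq0 (negPf l0) => /eqP ->; split=> //.
by apply: (mulfI l0); rewrite -ae -dh.
Qed.

Lemma mscalar_conj M N : mdet M != 0 -> mscalar (mmul (mmul M N) (madj M)) ->
  mscalar N.
Proof.
move=> M0 H; have {H} : exists k, mmul (mmul M N) (madj M) = mscale k (m1 D).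
  case: (mmul _ _) H => [[[a b] c] d] [-> -> ->]; exists d.
  by rewrite /m1 /= !mulr1 !mulr0.
case=> k e; have {e} : mmul (madj M) (mmul (mmul (mmul M N) (madj M)) M) =
    mmul (madj M) (mmul (mscale k (m1 D)) M) by rewrite e.
rewrite -!mmulA madj_mul !mscaler mmulr1 (mmulA (madj M)) madj_mul.
rewrite !mscalel !mmul1 mscaler madj_mul !mscaleA.
case: N => [[[a b] c] d]; rewrite /m1 /= => -[]; rewrite !mulr0 !mulr1 => e1 e2 e3 e4.
have M1 : mdet M * mdet M != 0 by rewrite mulf_neq0.
split; apply: (mulfI M1); rewrite ?mulr0 ?e2 ?e3 // e1 e4 //.
Qed.

(** A nonzero row of [A] kills the columns of both [B] and [C], so these lie on one line; the
    entries of [mmul (madj B) C] are, up to sign, determinants of a column of [B] and a column of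
    [C]. *)
Lemma kernel_adj A B C : A != m0 -> mmul A B = m0 ->
  mmul A C = m0 -> mmul (madj B) C = m0.
Proof.
have row (p q b1 b2 b3 b4 c1 c2 c3 c4 : D) : (p != 0) || (q != 0) ->
    p * b1 + q * b3 = 0 -> p * b2 + q * b4 = 0 ->
    p * c1 + q * c3 = 0 -> p * c2 + q * c4 = 0 ->
    mmul (madj (b1, b2, b3, b4)) (c1, c2, c3, c4) = m0.
  move=> pq e1 e2 e3 e4; rewrite /m0 /=.
  have kill k : p * k = 0 -> q * k = 0 -> k = 0.
    by move=> /eqP + /eqP; rewrite !mulf_eq0; case/orP: pq => /negPf-> /=;
      [move=> /eqP | move=> _ /eqP].
  (* Each entry, multiplied by [p] and by [q], is a combination of the hypotheses as in Cramer's
     rule. *)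
  congr (_, _, _, _); apply: kill.
  - transitivity (b4 * (p * c1 + q * c3) - c3 * (p * b2 + q * b4)); first by ring.
    by rewrite e3 e2; ring.
  - transitivity (c1 * (p * b2 + q * b4) - b2 * (p * c1 + q * c3)); first by ring.
    by rewrite e3 e2; ring.
  - transitivity (b4 * (p * c2 + q * c4) - c4 * (p * b2 + q * b4)); first by ring.
    by rewrite e4 e2; ring.
  - transitivity (c2 * (p * b2 + q * b4) - b2 * (p * c2 + q * c4)); first by ring.
    by rewrite e4 e2; ring.
  - transitivity (c3 * (p * b1 + q * b3) - b3 * (p * c1 + q * c3)); first by ring.
    by rewrite e3 e1; ring.
  - transitivity (b1 * (p * c1 + q * c3) - c1 * (p * b1 + q * b3)); first by ring.
    by rewrite e3 e1; ring.
  - transitivity (c4 * (p * b1 + q * b3) - b3 * (p * c2 + q * c4)); first by ring.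
    by rewrite e4 e1; ring.
  - transitivity (b1 * (p * c2 + q * c4) - c2 * (p * b1 + q * b3)); first by ring.
    by rewrite e4 e1; ring.
move: A B C => [[[p q] p'] q'] [[[b1 b2] b3] b4] [[[c1 c2] c3] c4].
rewrite /m0 !xpair_eqE !negb_and => A0 [e1 e2 e3 e4] [f1 f2 f3 f4].
have [pq|] := boolP ((p != 0) || (q != 0)); first exact: (row p q).
rewrite negb_or !negbK => /andP[/eqP p0 /eqP q0]; subst p q.
by apply: (row p' q') => //; rewrite !eqxx in A0.
Qed.

End Domain.

(** * Distance between lattices *)

Section Delta.

Variable F : fieldType.

Local Notation D := (pseries F).
Local Notation t := (ps_t F).
Local Notation v := (@ps_val F).
Local Notation res := (@ps_res F).

Implicit Types (M N U : mat2 D) (n : nat) (k : D).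

Definition mprim M : bool := mmap res M != m0 F.

Lemma mat_shift n M :
    (forall i, (i < n)%N -> mmap (fun x => coefs x i) M = m0 F) ->
  M = mscale (t ^+ n) (mmap (ps_shift n) M).
Proof.
move: M => [[[a b] c] d] H; rewrite /=.
by congr (_, _, _, _); apply: ps_shiftE => i /H [].
Qed.

Lemma mat_nz_coef M : mdet M != 0 -> exists n, mmap (fun x => coefs x n) M != m0 F.
Proof.
move=> /eqP M0; apply: contrapT => H; apply: M0.
case: M H => [[[a b] c] d] H.
have coef0 i : mmap (fun x : D => coefs x i) (a, b, c, d) = m0 F.
  by apply/eqP/negPn/negP => Hi; apply: H; exists i.
have -> : a = 0 by apply: pseriesP => i; rewrite [RHS]mul0rn; case: (coef0 i).
have -> : b = 0 by apply: pseriesP => i; rewrite [RHS]mul0rn; case: (coef0 i).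
by rewrite /= !mul0r subr0.
Qed.

Definition mval M : nat :=
  if pselect (exists n, mmap (fun x => coefs x n) M != m0 F) is left MP
  then ex_minn MP else 0.

Lemma mval_split M : mdet M != 0 ->
  exists2 N, mprim N & M = mscale (t ^+ mval M) N.
Proof.
move=> /mat_nz_coef ex; rewrite /mval; case: pselect => // {}ex.
case: ex_minnP => n Mn min_n; exists (mmap (ps_shift n) M).
  by move: M Mn {ex min_n} => [[[a b] c] d] /=; rewrite /mprim /ps_res /= addn0.
apply: mat_shift => i i_n; apply/eqP; case: eqP => // /eqP /min_n.
by rewrite leqNgt i_n.
Qed.

Lemma t_res0 k : res k = 0 -> exists l, k = t * l.
Proof.
move=> k0; exists (ps_shift 1 k); rewrite -[t]expr1.
by apply: ps_shiftE => -[].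
Qed.

Lemma mprimPn M : ~~ mprim M -> exists N, M = mscale t N.
Proof.
move: M => [[[a b] c] d] /negPn/eqP[].
move=> /t_res0[a' ->] /t_res0[b' ->] /t_res0[c' ->] /t_res0[d' ->].
by exists (a', b', c', d').
Qed.

Lemma mprim_scale k M : mprim (mscale k M) = (res k != 0) && mprim M.
Proof.
rewrite /mprim mmap_scale; case: (mmap _ M) => [[[a b] c] d] /=.
have [->|k0] /= := eqVneq (res k) 0; first by rewrite !mul0r eqxx.
by rewrite /m0 !xpair_eqE !mulf_eq0 (negPf k0).
Qed.

Lemma mprim_mulU U M : res (mdet U) != 0 -> mprim M -> mprim (mmul U M).
Proof.
move=> U0; apply: contra => /eqP UM; apply/eqP.
rewrite -mmap_det in U0; rewrite mmap_mul in UM.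
have: mmul (madj (mmap res U)) (mmul (mmap res U) (mmap res M)) = m0 F.
  by rewrite UM; case: (mmap res U) => [[[a b] c] d] /=; rewrite !mulr0 addr0.
rewrite mmulA madj_mul mscalel mmul1 => e; apply: (mscale_inj U0).
by rewrite e /m0 /= !mulr0.
Qed.

Lemma mprim_adj M : mprim (madj M) = mprim M.
Proof.
rewrite /mprim mmap_adj; case: (mmap res M) => [[[a b] c] d] /=.
rewrite /m0 !xpair_eqE !oppr_eq0.
by case: (a == 0) (b == 0) (c == 0) (d == 0) => [] [] [] [].
Qed.

Lemma mprim_uniq n n' M M' : mprim M -> mprim M' ->
  mscale (t ^+ n) M = mscale (t ^+ n') M' -> n = n'.
Proof.
wlog le_n : n n' M M' / (n <= n')%N => [H|].
  case/orP: (leq_total n n') => le pM pM' e; first exact: H e.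
  by apply: esym; apply: H (esym e).
move=> pM pM'; rewrite -(subnK le_n) addnC exprD -mscaleA => e.
have {}e := mscale_inj (expf_neq0 n (ps_t_neq0 F)) e.
case: (n' - n)%N e => [|m] e; first by rewrite addn0.
by move: pM; rewrite e mprim_scale rmorphXn /= ps_res_t expr0n eqxx.
Qed.

Lemma mvalE k M : k != 0 -> mdet M != 0 -> mprim M -> mval (mscale k M) = v k.
Proof.
move=> k0 dM pM.
have [|N pN] := @mval_split (mscale k M).
  by rewrite mdet_scale mulf_neq0 ?expf_neq0.
have [l l0 kE] := ps_val_split k0; rewrite {1}kE -mscaleA => e.
by apply: esym; apply: mprim_uniq e; rewrite ?mprim_scale ?l0.
Qed.

(** If t^i and t^j are the elementary divisors of [M], with i <= j, then [mval M] is i and this is j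
    - i: the distance in the tree from M O^2 to O^2. *)
Definition delta M : nat := v (mdet M) - (mval M).*2.

Lemma deltaE k M : k != 0 -> mdet M != 0 -> mprim M ->
  delta (mscale k M) = v (mdet M).
Proof.
move=> k0 dM pM; rewrite /delta mvalE // mdet_scale ps_valM ?expf_neq0 //.
by rewrite ps_valX // -mul2n addKn.
Qed.

Lemma prim_factor M : mdet M != 0 ->
  exists k N, [/\ k != 0, mdet N != 0, mprim N & M = mscale k N].
Proof.
move=> dM; have [N pN e] := mval_split dM.
exists (t ^+ mval M), N; split; rewrite ?expf_neq0 ?ps_t_neq0 //.
by apply: contraNneq dM => dN; rewrite e mdet_scale dN mulr0.
Qed.

Lemma delta_scale k M : k != 0 -> mdet M != 0 -> delta (mscale k M) = delta M.
Proof.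
move=> k0 /prim_factor[l [N [l0 dN pN ->]]].
by rewrite mscaleA !deltaE // mulf_neq0.
Qed.

Lemma delta_prop M N : mdet M != 0 -> mprop M N -> delta M = delta N.
Proof.
move=> dM MN; have dN : mdet N != 0 by rewrite -(mprop_det MN).
by case: MN => k [l [k0 l0 e]]; rewrite -(delta_scale k0 dM) e delta_scale.
Qed.

Lemma delta_adj M : mdet M != 0 -> delta (madj M) = delta M.
Proof.
move=> /prim_factor[l [N [l0 dN pN ->]]].
by rewrite madj_scale !deltaE ?mprim_adj ?mdet_adj.
Qed.

Lemma delta_det0 U : res (mdet U) != 0 -> delta U = 0%N.
Proof.
move=> rU; have dU: mdet U != 0 by apply: contraNneq rU => ->; rewrite rmorph0.
by rewrite /delta ps_res_val.
Qed.

Lemma delta0P M : mdet M != 0 -> delta M = 0%N ->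
  exists k U, [/\ k != 0, res (mdet U) != 0 & M = mscale k U].
Proof.
move=> /prim_factor[k [U [k0 dU pU ->]]]; rewrite deltaE // => v0.
by exists k, U; split=> //; apply/eqP => /(ps_val_res dU); rewrite v0.
Qed.

(** Here [M] is a scalar times an element of GL_2(O), and the latter preserves primitivity. *)
Lemma delta_mull M N : mdet M != 0 -> mdet N != 0 -> delta M = 0%N ->
  delta (mmul M N) = delta N.
Proof.
move=> dM /prim_factor[l [P [l0 dP pP ->]]] /(delta0P dM)[k [U [k0 rU ->]]].
have dU: mdet U != 0 by apply: contraNneq rU => ->; rewrite rmorph0.
rewrite mscaler mscalel mscaleA !deltaE ?mulf_neq0 // ?mprim_mulU //.
  by rewrite mdetM ps_valM // ps_res_val.
by rewrite mdetM mulf_neq0.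
Qed.

Lemma odd_delta M : mdet M != 0 -> odd (delta M) = odd (v (mdet M)).
Proof.
move=> /prim_factor[k [U [k0 dU pU ->]]]; rewrite deltaE // mdet_scale.
by rewrite ps_valM ?expf_neq0 // ps_valX // mul2n oddD odd_double.
Qed.

Definition mdist M N : nat := delta (mmul (madj M) N).

Lemma mdist_refl M : mdet M != 0 -> mdist M M = 0%N.
Proof.
move=> dM; rewrite /mdist madj_mul deltaE ?mdet1 ?oner_eq0 //.
  by rewrite ps_res_val // rmorph1 oner_eq0.
by rewrite /mprim mmap1 /m0 !xpair_eqE oner_eq0.
Qed.

Lemma mdist_sym M N : mdet M != 0 -> mdet N != 0 -> mdist M N = mdist N M.
Proof.
move=> dM dN; rewrite /mdist -delta_adj ?madjM ?madjK //.
by rewrite mdetM mdet_adj mulf_neq0.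
Qed.

Lemma mdist_mull U M N : mdet U != 0 -> mdet M != 0 -> mdet N != 0 ->
  mdist (mmul U M) (mmul U N) = mdist M N.
Proof.
move=> dU dM dN; rewrite /mdist madjM -mmulA (mmulA _ U) madj_mul mscalel mmul1.
by rewrite mscaler delta_scale // mdetM mdet_adj mulf_neq0.
Qed.

(** Up to scalars, [mmul (madj M) P] is the product of [mmul (madj M) N], whose [delta] is 0, and
    [mmul (madj N) P]. *)
Lemma mdist_congl M N P : mdet M != 0 -> mdet N != 0 -> mdet P != 0 ->
  mdist M N = 0%N -> mdist M P = mdist N P.
Proof.
move=> dM dN dP MN.
have dMN : mdet (mmul (madj M) N) != 0 by rewrite mdetM mdet_adj mulf_neq0.
have dMP : mdet (mmul (madj M) P) != 0 by rewrite mdetM mdet_adj mulf_neq0.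
have dNP : mdet (mmul (madj N) P) != 0 by rewrite mdetM mdet_adj mulf_neq0.
rewrite /mdist -(delta_mull dMN dNP) // -mmulA (mmulA N) mmul_adj mscalel mmul1.
by rewrite mscaler delta_scale.
Qed.

Lemma mdist_propl M N P : mdet M != 0 -> mdet P != 0 -> mprop M N ->
  mdist M P = mdist N P.
Proof.
move=> dM dP [k [l [k0 l0 e]]].
apply: delta_prop; first by rewrite mdetM mdet_adj mulf_neq0.
apply: mprop_mul (mprop_refl _); exists k, l.
by rewrite -!madj_scale e.
Qed.

Lemma mdist_propr M N P : mdet M != 0 -> mdet P != 0 -> mprop M N ->
  mdist P M = mdist P N.
Proof.
move=> dM dP MN; have dN: mdet N != 0 by rewrite -(mprop_det MN).
by rewrite mdist_sym // (mdist_propl dM dP MN) mdist_sym.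
Qed.

End Delta.

(** * Words and matrices *)

Section Words.

Variables (X : choiceType) (R : seq (X * bool) -> Prop).

(** A right action on states that respects the relators gives an invariant of words; used for the
    Heisenberg group and for the cyclic cover. *)
Lemma foldl_word_eq (T : Type) (step : T -> X * bool -> T) :
    (forall x b s, step (step s (x, b)) (x, ~~ b) = s) ->
    (forall r s, R r -> foldl step s r = s) ->
  forall u v, word_eq R u v -> forall s, foldl step s u = foldl step s v.
Proof.
move=> stepK stepR u v; elim=> {u v} [//|u v _ IH s|u v w _ IHu _ IHv s|
  u u' v v' _ IHu _ IHv s|x b s|r Rr s]; rewrite ?foldl_cat //=.
- by rewrite IHu.
- by rewrite IHu.
- exact: stepR.
Qed.

Lemma word_eq_catl u v w : word_eq R u v -> word_eq R (w ++ u) (w ++ v).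
Proof. exact/word_eq_cat/word_eq_refl. Qed.

Lemma word_eq_catr u v w : word_eq R u v -> word_eq R (u ++ w) (v ++ w).
Proof. by move=> uv; apply: word_eq_cat (word_eq_refl _ _). Qed.

Lemma word_eq_cancelV u v : word_eq R (u ++ word_inv v) [::] -> word_eq R u v.
Proof.
move=> uv; apply: (@word_eq_trans _ _ _ (u ++ (word_inv v ++ v))).
  rewrite -[X in word_eq _ X _]cats0; apply/word_eq_catl/word_eq_sym.
  exact: word_Vmul.
by rewrite catA -[X in word_eq _ _ X]cat0s; apply: word_eq_catr.
Qed.

Definition wpow n (w : seq (X * bool)) := flatten (nseq n w).

Lemma wpowSr n w : wpow n.+1 w = wpow n w ++ w.
Proof.
by elim: n => [|n IHn]; rewrite /wpow /= ?cats0 // -/(wpow n w) -catA -IHn.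
Qed.

Lemma word_inv_pow n w : word_inv (wpow n w) = wpow n (word_inv w).
Proof. by elim: n => // n IHn; rewrite wpowSr word_inv_cat IHn. Qed.

End Words.

(** * Evaluation of words at matrices *)

Section WordMatrices.

Variables (X : choiceType) (D : idomainType) (f : X -> mat2 D).
Hypothesis f_det : forall x, mdet (f x) != 0.

Definition lmat (l : X * bool) : mat2 D := if l.2 then madj (f l.1) else f l.1.
Definition wmat (w : seq (X * bool)) : mat2 D := foldr (fun l => mmul (lmat l)) (m1 D) w.

Lemma wmat_cons l w : wmat (l :: w) = mmul (lmat l) (wmat w).
Proof. by []. Qed.

Lemma wmat1 l : wmat [:: l] = lmat l.
Proof. by rewrite wmat_cons; apply: mmulr1. Qed.

Lemma wmat_cat u v : wmat (u ++ v) = mmul (wmat u) (wmat v).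
Proof. by elim: u => [|l u IHu] /=; [rewrite mmul1 | rewrite IHu mmulA]. Qed.

Lemma lmat_det l : mdet (lmat l) != 0.
Proof. by case: l => x []; rewrite /lmat /= ?mdet_adj. Qed.

Lemma wmat_det w : mdet (wmat w) != 0.
Proof.
elim: w => [|l w IHw]; first by rewrite mdet1 oner_eq0.
by rewrite mdetM mulf_neq0 ?lmat_det.
Qed.

Lemma lmat_inv x b : lmat (x, ~~ b) = madj (lmat (x, b)).
Proof. by case: b; rewrite /lmat /= ?madjK. Qed.

Lemma wmat_inv w : wmat (word_inv w) = madj (wmat w).
Proof.
elim: w => [|[x b] w IHw]; first by rewrite [RHS]madj1.
rewrite -cat1s word_inv_cat wmat_cat IHw /= mmulr1 lmat_inv.
by rewrite madjM.
Qed.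

Lemma wmat_mulV w : mprop (mmul (wmat w) (madj (wmat w))) (m1 D).
Proof. by rewrite mmul_adj; apply/mprop_scale/wmat_det. Qed.

Lemma wmat_word_eq R : (forall r, R r -> mprop (wmat r) (m1 D)) ->
  forall u v, word_eq R u v -> mprop (wmat u) (wmat v).
Proof.
move=> Rf u v; elim=> {u v} [u|u v _|u v w _ uv _|u u' v v' _ uu' _ vv'|x b|r /Rf//].
- exact: mprop_refl.
- exact: mprop_sym.
- exact: mprop_trans.
- by rewrite !wmat_cat; apply: mprop_mul.
- by have := wmat_mulV [:: (x, b)]; rewrite -wmat_inv -wmat_cat.
Qed.

End WordMatrices.

(** * Hyperbolic matrices *)

Section Hyperbolic.

Variable F : fieldType.

Local Notation D := (pseries F).

(** By the Newton polygon of the characteristic polynomial, this says that the eigenvalues have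
    different valuations. *)
Definition hyperbolic_mat (M : mat2 D) : Prop :=
  mtr M != 0 /\ ((ps_val (mtr M)).*2 < ps_val (mdet M))%N.

Lemma hyp_scale k (M : mat2 D) : mdet M != 0 -> k != 0 ->
  hyperbolic_mat (mscale k M) <-> hyperbolic_mat M.
Proof.
move=> dM k0; rewrite /hyperbolic_mat mtr_scale mdet_scale mulf_eq0 (negPf k0) /=.
by split=> -[tM]; rewrite !ps_valM ?mulf_neq0 // => lt; split=> //; lia.
Qed.

Lemma hyp_prop (M N : mat2 D) : mdet M != 0 -> mprop M N -> hyperbolic_mat M -> hyperbolic_mat N.
Proof.
move=> dM MN; have dN : mdet N != 0 by rewrite -(mprop_det MN).
case: MN => k [l [k0 l0 e]] hM; apply/(hyp_scale dN l0); rewrite -e.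
exact/hyp_scale.
Qed.

Lemma hyp_conj (M N : mat2 D) : mdet M != 0 -> mdet N != 0 ->
  hyperbolic_mat N -> hyperbolic_mat (mmul (mmul M N) (madj M)).
Proof.
move=> dM dN; rewrite /hyperbolic_mat mtr_conj !mdetM mdet_adj => -[tN lt].
by rewrite mulf_neq0 // !ps_valM ?mulf_neq0 //; split=> //; lia.
Qed.

Definition triangular (M : mat2 D) : bool :=
  let: (a, b, c, d) := M in (b == 0) || (c == 0).

(** The determinant is [a * d], of valuation 2 v(d), while a nonzero trace has valuation at least
    v(d). *)
Lemma triangular_nhyp a b c d : triangular (a, b, c, d) -> a != 0 -> d != 0 ->
  ps_val a = ps_val d -> ~ hyperbolic_mat (a, b, c, d).
Proof.
move=> /= tri a0 d0 v_ad; rewrite /hyperbolic_mat /=.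
have -> : b * c = 0 by case/orP: tri => /eqP->; rewrite ?mulr0 ?mul0r.
rewrite subr0 ps_valM // v_ad => -[ad0].
have [_ az] := ps_valP a0; have [_ dz] := ps_valP d0.
suff: (ps_val d <= ps_val (a + d)%R)%N by lia.
rewrite leqNgt; apply/negP => lt; have [/negP+ _] := ps_valP ad0; apply.
by rewrite /= az ?dz ?addr0 // v_ad.
Qed.

End Hyperbolic.

(** * A Schottky pair over F_3[[t]] *)

Section SchottkyPair.

Local Notation D := (pseries 'F_3).
Local Notation t := (ps_t 'F_3).
Local Notation v := (@ps_val 'F_3).
Local Notation res := (@ps_res 'F_3).

(* Up to scalars these are I1 I2 and I3 I2, where I1, I2, I3 have trace zero   *)
(* and I1 I2 I3 is diag(1, t^2). The commutator is then the square of I1 I2 I3. *)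
Definition gmat (b : bool) : mat2 D :=
  if b then (t ^+ 2, t, 2%:R + t ^+ 2, -1) else (1, -1, t, - t ^+ 2).

Notation lm := (lmat gmat).
Notation wm := (wmat gmat).

Lemma gmat_det_t b : exists2 u, res u != 0 & mdet (gmat b) = t * u.
Proof.
case: b; [exists (- (2%:R + t + t ^+ 2)) | exists (1 - t)].
- by rewrite rmorphN !rmorphD rmorphXn.
- by rewrite /=; ring.
- by rewrite rmorphD rmorphN.
- by rewrite /=; ring.
Qed.

Lemma lmat_det_t l : exists2 u, res u != 0 & mdet (lm l) = t * u.
Proof. by case: l => b []; rewrite /lmat /= ?mdet_adj; apply: gmat_det_t. Qed.

Lemma gmat_det b : mdet (gmat b) != 0.
Proof.
have [u u0 ->] := gmat_det_t b; rewrite mulf_neq0 ?ps_t_neq0 //.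
by apply: contraNneq u0 => ->; rewrite rmorph0.
Qed.

Lemma val_lmat_det l : v (mdet (lm l)) = 1%N.
Proof.
have [u u0 ->] := lmat_det_t l; rewrite ps_valM ?ps_t_neq0 ?ps_val_t ?ps_res_val //.
by apply: contraNneq u0 => ->; rewrite rmorph0.
Qed.

Lemma val_wmat_det w : v (mdet (wm w)) = size w.
Proof.
elim: w => [|l w IHw]; first by rewrite mdet1 ps_res_val // rmorph1.
by rewrite mdetM ps_valM ?lmat_det ?wmat_det ?val_lmat_det ?IHw //; apply: gmat_det.
Qed.

(* The residue of each of the four letters has rank one: it is the product of *)
(* the column [im_vec] and the row [ker_form]. The four images are the four   *)
(* points of the projective line over 'F_3.                                   *)
Definition im_vec (l : bool * bool) : 'F_3 * 'F_3 :=
  match l with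
  | (false, false) => (1, 0) | (false, true) => (1, 1)
  | (true, false) => (0, 1) | (true, true) => (-1, 1)
  end.

Definition ker_form (l : bool * bool) : 'F_3 * 'F_3 :=
  match l with
  | (false, false) => (1, -1) | (false, true) => (0, 1)
  | (true, false) => (-1, -1) | (true, true) => (1, 0)
  end.

Definition outer (x y : 'F_3 * 'F_3) : mat2 'F_3 :=
  (x.1 * y.1, x.1 * y.2, x.2 * y.1, x.2 * y.2).

Definition pairing (y x : 'F_3 * 'F_3) : 'F_3 := y.1 * x.1 + y.2 * x.2.

Lemma outer_mul x y x' y' :
  mmul (outer x y) (outer x' y') = mscale (pairing y x') (outer x y').
Proof. by rewrite /outer /pairing /=; congr (_, _, _, _); ring. Qed.

Lemma res_lmat l : mmap res (lm l) = outer (im_vec l) (ker_form l).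
Proof.
case: l => [[] []]; rewrite /lmat /= ?rmorphN ?rmorphD ?rmorph_nat ?rmorph1 ?rmorphXn /=
  ?rmorph_nat ?ps_res_t; by apply/eqP.
Qed.

Definition ncancel (l l' : bool * bool) : bool := l' != (l.1, ~~ l.2).

Lemma pairing_neq0 l l' : ncancel l l' -> pairing (ker_form l) (im_vec l') != 0.
Proof. by case: l l' => [[] []] [[] []]. Qed.

(** In a product of outer products only the first column and the last row survive, times the
    pairings at the junctions; these vanish only at cancelling pairs. *)
Lemma res_wmat_path l w : path ncancel l w -> exists2 k, k != 0 &
  mmap res (wm (l :: w)) = mscale k (outer (im_vec l) (ker_form (last l w))).
Proof.
elim: w l => [|l' w IHw] l; last first.
  case/andP=> /pairing_neq0 p0 /IHw[k k0 e].
  exists (k * pairing (ker_form l) (im_vec l')); first by rewrite mulf_neq0.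
  by rewrite wmat_cons mmap_mul e res_lmat mscaler outer_mul mscaleA.
move=> _; exists 1 => //.
by rewrite wmat1 mscale1 res_lmat.
Qed.

(** The residue of the trace is a product of nonzero pairings around the cycle, so the trace is a
    unit, whereas the determinant has valuation [size w]. *)
Lemma cycle_hyp w : w != [::] -> cycle ncancel w -> hyperbolic_mat (wm w).
Proof.
case: w => // l w _; rewrite /cycle rcons_path => /andP[lw last_l].
have [k k0 e] := res_wmat_path lw.
have tr0 : res (mtr (wm (l :: w))) != 0.
  rewrite -mmap_tr e mtr_scale mulf_neq0 //.
  have := pairing_neq0 last_l; rewrite /pairing /= [_ * (im_vec l).1]mulrC.
  by rewrite [_ * (im_vec l).2]mulrC.
split; first by apply: contraNneq tr0 => ->; rewrite rmorph0.
by rewrite val_wmat_det ps_res_val.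
Qed.

(** The columns of [N] span a point of the projective line over 'F_3, hence the image of the residue
    of some letter, which the adjugate annihilates. *)
Lemma rank_one_image (N : mat2 'F_3) : N != m0 _ -> mdet N = 0 ->
  exists l, mmul (madj (mmap res (lm l))) N = m0 _.
Proof.
move=> N0 dN; suff: [exists l, mmul (madj (outer (im_vec l) (ker_form l))) N == m0 _].
  by case/existsP=> l /eqP e; exists l; rewrite res_lmat.
move: N N0 dN => [[[a b] c] d] N0 /eqP dN; apply/existsP.
(* The four points of the projective line, in the order of the witnesses below; the matrices over
   'F_3 are enumerated. *)
have : [|| [&& c == 0 & d == 0], [&& a == c & b == d],
         [&& a == 0 & b == 0] | [&& a == - c & b == - d]].
  case: a b c d N0 dN => [[|[|[|//]]] ?] [[|[|[|//]]] ?] [[|[|[|//]]] ?] [[|[|[|//]]] ?];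
  by [].
case/or4P => /andP[/eqP-> /eqP->].
- by exists (false, false); rewrite /outer /m0 /=; apply/eqP; congr (_, _, _, _); ring.
- by exists (false, true); rewrite /outer /m0 /=; apply/eqP; congr (_, _, _, _); ring.
- by exists (true, false); rewrite /outer /m0 /=; apply/eqP; congr (_, _, _, _); ring.
- by exists (true, true); rewrite /outer /m0 /=; apply/eqP; congr (_, _, _, _); ring.
Qed.

End SchottkyPair.

(** * The tree of lattices *)

Section LatticeTree.

Local Notation D := (pseries 'F_3).
Local Notation t := (ps_t 'F_3).
Local Notation v := (@ps_val 'F_3).
Local Notation res := (@ps_res 'F_3).
Local Notation lm := (lmat gmat).
Local Notation wm := (wmat gmat).

Implicit Types (M N g h : mat2 D).

Let lm_det l : mdet (lm l) != 0 := lmat_det gmat_det l.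
Let wm_det w : mdet (wm w) != 0 := wmat_det gmat_det w.

(** Take the letter whose residue has the same image as that of [N]. Its adjugate makes [N]
    divisible by t and adds only 1 to the valuation of the determinant; dividing by t takes away
    2. *)
Lemma letter_step n M : mdet M != 0 -> delta M = n.+1 ->
  exists l, delta (mmul (madj (lm l)) M) = n.
Proof.
move=> /prim_factor[k [N [k0 dN pN ->]]]; rewrite deltaE // => vN.
have [l lN] : exists l, mmul (madj (mmap res (lm l))) (mmap res N) = m0 _.
  apply: rank_one_image => //; rewrite mmap_det; apply/eqP.
  by apply: contraTT isT => /ps_res_val; rewrite vN.
have [P lNP] : exists P, mmul (madj (lm l)) N = mscale t P.
  by apply: mprimPn; rewrite /mprim mmap_mul mmap_adj lN eqxx.
have t0 := ps_t_neq0 'F_3.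
have e : mdet (lm l) * mdet N = t ^+ 2 * mdet P.
  by rewrite -mdet_scale -lNP mdetM mdet_adj.
have dP : mdet P != 0.
  apply: contraTneq (mulf_neq0 (lm_det l) dN) => dP.
  by rewrite e dP mulr0 eqxx.
exists l; rewrite mscaler lNP mscaleA deltaE ?mulf_neq0 //; last first.
  (* If [P] were divisible by t, multiplying back by the letter would make [N] divisible by t as
     well. *)
  have [//|/mprimPn[Q PQ]] := boolP (mprim P).
  have [u u0 lE] := lmat_det_t l.
  have: mscale t (mscale u N) = mscale t (mscale t (mmul (lm l) Q)).
    by rewrite -mscaler -PQ -mscaler -lNP mmulA mmul_adj mscalel mmul1 lE mscaleA.
  move/(mscale_inj t0)/(congr1 (@mprim _)).
  by rewrite !mprim_scale u0 pN ps_res_t eqxx.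
move/(congr1 v): e; rewrite !ps_valM ?mulf_neq0 // ps_val_t.
by rewrite val_lmat_det vN => -[].
Qed.

(** Iterated [letter_step]; connectedness and local finiteness of the tree and transitivity of the
    action come from this. *)
Lemma reach n g h : mdet g != 0 -> mdet h != 0 -> mdist g h = n ->
  exists2 w, size w = n & mdist (mmul g (wm w)) h = 0%N.
Proof.
elim: n g => [|n IHn] g dg dh gh.
  by exists [::]; rewrite //= mmulr1.
have [|l lh] := letter_step _ gh; first by rewrite mdetM mdet_adj mulf_neq0.
have [||w sw wh] := IHn (mmul g (lm l)) _ dh; first by rewrite mdetM mulf_neq0 ?lm_det.
  by rewrite /mdist madjM -mmulA.
by exists (l :: w); rewrite /= ?sw // mmulA.
Qed.

Lemma mdist_lmat g l : mdet g != 0 -> mdist g (mmul g (lm l)) = 1%N.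
Proof.
move=> dg; rewrite /mdist mmulA madj_mul mscalel mmul1 delta_scale ?lm_det //.
rewrite -[lm l]mscale1 deltaE ?oner_neq0 ?lm_det ?val_lmat_det //.
by rewrite /mprim res_lmat; case: (l) => [[] []].
Qed.

(** If the product stayed primitive, the distance would be the valuation of its determinant, which
    exceeds that of [g]. *)
Lemma closer_nprim g h : mdet g != 0 -> mprim g -> mdet h != 0 -> mprim h ->
  v (mdet h) = 1%N -> (mdist g h < v (mdet g))%N ->
  mmul (madj (mmap res g)) (mmap res h) = m0 _.
Proof.
move=> dg pg dh ph vh lt; apply/eqP/negPn/negP.
rewrite -mmap_adj -mmap_mul => pgh; move: lt.
rewrite /mdist -[mmul _ _]mscale1 deltaE ?oner_neq0 ?mdetM ?mdet_adj ?mulf_neq0 //.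
by rewrite ps_valM // vh addn1 ltnNge leqnSn.
Qed.

Lemma mdist1 M : mdist (m1 D) M = delta M.
Proof. by rewrite /mdist madj1 mmul1. Qed.

(** Modulo t, the primitive representatives of [h] and [h'] have their columns in the kernel of the
    adjugate of that of [g], a line. So adj(h) h' is divisible by t, and the quotient has
    determinant of valuation 1 + 1 - 2 = 0. *)
Lemma parent_uniq1 g h h' : mdet g != 0 -> mdet h != 0 -> mdet h' != 0 ->
  delta h = 1%N -> delta h' = 1%N ->
  (mdist g h < delta g)%N -> (mdist g h' < delta g)%N -> mdist h h' = 0%N.
Proof.
have prop k (N : mat2 D) : k != 0 -> mprop (mscale k N) N by exact: mprop_scale.
move=> dg dh dh' h1 h1'.
have [k [G [k0 dG pG gE]]] := prim_factor dg.
have [l [H [l0 dH pH hE]]] := prim_factor dh.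
have [l' [H' [l0' dH' pH' hE']]] := prim_factor dh'.
move: h1 h1' dg dh dh'; rewrite gE hE hE' !deltaE // => vH vH' dg dh dh'.
rewrite !(mdist_propl dg _ (prop _ _ k0)) //.
rewrite (mdist_propr dh dG (prop _ _ l0)) (mdist_propr dh' dG (prop _ _ l0')).
rewrite (mdist_propr dh' dh (prop _ _ l0')) (mdist_propl dh dH' (prop _ _ l0)).
move=> /(closer_nprim dG pG dH pH vH) GH /(closer_nprim dG pG dH' pH' vH') GH'.
have G0 : madj (mmap res G) != m0 _ by rewrite -mmap_adj -/(mprim _) mprim_adj.
have HH' := kernel_adj G0 GH GH'.
have [P eP] : exists P, mmul (madj H) H' = mscale t P.
  by apply: mprimPn; rewrite /mprim mmap_mul mmap_adj HH' eqxx.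
have e : mdet H * mdet H' = t ^+ 2 * mdet P.
  by rewrite -mdet_scale -eP mdetM mdet_adj.
have dP : mdet P != 0.
  apply: contraTneq (mulf_neq0 dH dH') => dP.
  by rewrite e dP mulr0 eqxx.
rewrite /mdist eP delta_scale ?ps_t_neq0 // delta_det0 //.
have vP : v (mdet P) = 0%N.
  move/(congr1 v): e; rewrite !ps_valM ?mulf_neq0 ?ps_t_neq0 // vH vH'.
  by rewrite ps_val_t => -[].
by have [] := ps_valP dP; rewrite vP.
Qed.

Lemma parent_uniq g x h h' : mdet g != 0 -> mdet x != 0 ->
  mdet h != 0 -> mdet h' != 0 -> mdist x h = 1%N -> mdist x h' = 1%N ->
  (mdist g h < mdist g x)%N -> (mdist g h' < mdist g x)%N -> mdist h h' = 0%N.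
Proof.
move=> dg dx dh dh' xh xh'.
have dx' : mdet (madj x) != 0 by rewrite mdet_adj.
have dm M : mdet M != 0 -> mdet (mmul (madj x) M) != 0.
  by move=> dM; rewrite mdetM mulf_neq0.
rewrite -(mdist_mull dx' dg dh) -(mdist_mull dx' dg dh') -(mdist_mull dx' dh dh').
by rewrite [mdist g x]mdist_sym //; apply: parent_uniq1; rewrite ?dm.
Qed.

Lemma odd_mdist M N : mdet M != 0 -> mdet N != 0 ->
  odd (mdist M N) = odd (v (mdet M)) (+) odd (v (mdet N)).
Proof.
move=> dM dN; rewrite odd_delta ?mdetM ?mdet_adj ?mulf_neq0 //.
by rewrite ps_valM // oddD.
Qed.

Definition gl2 := {M : mat2 D | mdet M != 0}.

Definition homothetic : rel gl2 := fun A B => mdist (val A) (val B) == 0%N.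

Lemma homothetic_equiv : equiv_class_of homothetic.
Proof.
split=> [M|M N|N M P]; rewrite /homothetic.
- by rewrite mdist_refl // (valP M).
- by rewrite mdist_sym // ?(valP M) ?(valP N).
- by move=> /eqP MN; rewrite (mdist_congl _ _ _ MN) ?(valP M) ?(valP N) ?(valP P).
Qed.

Canonical homothetic_equiv_rel := EquivRelPack homothetic_equiv.

Definition lattice : Type := {eq_quot homothetic}%qT.

HB.instance Definition _ := Choice.on lattice.
HB.instance Definition _ := EqQuotient.on lattice.

Lemma m1_det : mdet (m1 D) != 0. Proof. by rewrite mdet1 oner_eq0. Qed.

Definition gl2_one : gl2 := exist (fun M : mat2 D => mdet M != 0) (m1 D) m1_det.

(** The class of the lattice spanned by the columns of [M]; singular matrices give the standard
    lattice by default. *)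
Definition lclass M : lattice := (\pi_lattice (insubd gl2_one M))%qT.
Definition lmatrix (x : lattice) : mat2 D := val (repr x : gl2).

Lemma lmatrix_det x : mdet (lmatrix x) != 0.
Proof. exact: (valP (repr x : gl2)). Qed.

Lemma lclass_eq M N : mdet M != 0 -> mdet N != 0 ->
  lclass M = lclass N <-> mdist M N = 0%N.
Proof.
move=> dM dN; rewrite /lclass; split=> [/eqmodP|MN].
  by rewrite /= /homothetic !val_insubd dM dN => /eqP.
by apply/eqmodP; rewrite /= /homothetic !val_insubd dM dN MN.
Qed.

Lemma lclassK x : lclass (lmatrix x) = x.
Proof. by rewrite /lclass valKd; apply: reprK. Qed.

Lemma lmatrix_class M : mdet M != 0 -> mdist (lmatrix (lclass M)) M = 0%N.
Proof. by move=> dM; apply/lclass_eq; rewrite ?lmatrix_det ?lclassK. Qed.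

Definition ladj : rel lattice := fun x y => mdist (lmatrix x) (lmatrix y) == 1%N.

Lemma ladj_sym : symmetric ladj.
Proof. by move=> x y; rewrite /ladj mdist_sym ?lmatrix_det. Qed.

Lemma ladj_irr : irreflexive ladj.
Proof. by move=> x; rewrite /ladj mdist_refl ?lmatrix_det. Qed.

Lemma mdist_class M N : mdet M != 0 -> mdet N != 0 ->
  mdist (lmatrix (lclass M)) (lmatrix (lclass N)) = mdist M N.
Proof.
move=> dM dN.
rewrite (mdist_congl (lmatrix_det _) dM (lmatrix_det _) (lmatrix_class dM)).
rewrite (mdist_sym dM (lmatrix_det _)).
rewrite (mdist_congl (lmatrix_det _) dN dM (lmatrix_class dN)).
exact: mdist_sym.
Qed.

Lemma ladj_lmat g l : mdet g != 0 -> ladj (lclass g) (lclass (mmul g (lm l))).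
Proof.
move=> dg; rewrite /ladj mdist_class ?mdist_lmat //.
by rewrite mdetM mulf_neq0 ?lm_det.
Qed.

Lemma ladj_path w g : mdet g != 0 ->
  exists2 p, path ladj (lclass g) p & last (lclass g) p = lclass (mmul g (wm w)).
Proof.
elim: w g => [|l w IHw] g dg; first by exists [::]; rewrite //= mmulr1.
have [|p gp pw] := IHw (mmul g (lm l)); first by rewrite mdetM mulf_neq0 ?lm_det.
exists (lclass (mmul g (lm l)) :: p); first by rewrite /= ladj_lmat.
by rewrite [LHS]/= pw wmat_cons mmulA.
Qed.

Lemma lattice_reach x y :
  exists2 w, size w = mdist (lmatrix x) (lmatrix y) & y = lclass (mmul (lmatrix x) (wm w)).
Proof.
have [w sw xy] := reach (lmatrix_det x) (lmatrix_det y) erefl.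
exists w => //; rewrite -[LHS]lclassK; apply/esym/lclass_eq => //.
  by rewrite mdetM mulf_neq0 ?lmatrix_det ?wm_det.
exact: lmatrix_det.
Qed.

Lemma lattice_connected x y : exists2 p, path ladj x p & last x p = y.
Proof.
have [w _ ->] := lattice_reach x y.
by have := ladj_path w (lmatrix_det x); rewrite lclassK.
Qed.

Lemma seq_argmax (T : eqType) (f : T -> nat) x (s : seq T) :
  exists2 y, y \in x :: s & forall z, z \in x :: s -> (f z <= f y)%N.
Proof.
elim: s x => [|x' s IHs] x; first by exists x; rewrite ?mem_head // => z /[1!inE] /eqP->.
have [y ys y_max] := IHs x'.
have [le|lt] := leqP (f x) (f y).
  by exists y => [|z]; rewrite inE ?ys ?orbT // => /predU1P[->|/y_max].
exists x => [|z]; first exact: mem_head.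
by rewrite inE => /predU1P[->//|/y_max zy]; apply: leq_trans zy (ltnW lt).
Qed.

(* At a vertex of a cycle farthest from the standard lattice both neighbours  *)
(* are closer to it, by parity, so they coincide.                             *)
Lemma lattice_acyclic c : ucycle ladj c -> (size c <= 2)%N.
Proof.
move=> /andP[cyc uniq_c]; rewrite leqNgt; apply/negP => size_c.
case: c => // x0 c0 in cyc uniq_c size_c *.
have [x xc x_max] := seq_argmax (fun y => mdist (m1 D) (lmatrix y)) x0 c0.
have [i s rot_c] := rot_to xc.
rewrite -(rot_cycle i) rot_c in cyc; rewrite -(rot_uniq i) rot_c in uniq_c.
have mem_s y : y \in x :: s -> y \in x0 :: c0 by rewrite -rot_c mem_rot.
rewrite -(size_rot i) rot_c in size_c.
have closer y : y \in x :: s -> ladj x y ->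
    (mdist (m1 D) (lmatrix y) < mdist (m1 D) (lmatrix x))%N.
  move=> /mem_s/x_max le /eqP xy; rewrite ltn_neqAle le andbT.
  apply: contra_eqN (congr1 odd xy) => /eqP/(congr1 odd).
  rewrite !odd_mdist ?lmatrix_det ?m1_det //.
  by move/addbI => ->; rewrite addbb.
case: s => [|y s] in cyc uniq_c size_c closer {rot_c mem_s} *; first by [].
case: (lastP s) => [|s' z] in cyc uniq_c size_c closer *; first by [].
move: cyc; rewrite /cycle rcons_path /= last_rcons => /andP[/andP[xy _] zx].
rewrite ladj_sym in zx.
have zs : z \in [:: x, y & rcons s' z] by rewrite !inE mem_rcons mem_head !orbT.
have ys : y \in [:: x, y & rcons s' z] by rewrite !inE eqxx orbT.
have := parent_uniq m1_det (lmatrix_det x) (lmatrix_det y) (lmatrix_det z)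
  (eqP xy) (eqP zx) (closer y ys xy) (closer z zs zx).
move/(lclass_eq (lmatrix_det y) (lmatrix_det z)); rewrite !lclassK => yz.
by move: uniq_c; rewrite /= yz mem_rcons mem_head /= andbF.
Qed.

Definition lattice_tree : tree :=
  Tree ladj_sym ladj_irr (inhabits (lclass (m1 D))) lattice_connected lattice_acyclic.

Lemma lattice_locally_finite : locally_finite lattice_tree.
Proof.
move=> x; exists [seq lclass (mmul (lmatrix x) (lm l)) | l : bool * bool] => y xy.
have [w] := lattice_reach x y; rewrite (eqP xy).
by case: w => [|l []] // _ ->; rewrite wmat1; apply: image_f.
Qed.

Definition mact M (x : lattice) : lattice := lclass (mmul M (lmatrix x)).

Lemma mact_class M N : mdet M != 0 -> mdet N != 0 ->
  mact M (lclass N) = lclass (mmul M N).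
Proof.
move=> dM dN; apply/lclass_eq; rewrite ?mdetM ?mulf_neq0 ?lmatrix_det //.
by rewrite mdist_mull ?lmatrix_det ?lmatrix_class.
Qed.

Lemma mactM M N x : mdet M != 0 -> mdet N != 0 ->
  mact (mmul M N) x = mact M (mact N x).
Proof.
move=> dM dN; rewrite -[x]lclassK !mact_class ?mmulA ?mdetM ?mulf_neq0 ?lmatrix_det //.
Qed.

Lemma mact_prop M N x : mdet M != 0 -> mprop M N -> mact M x = mact N x.
Proof.
move=> dM MN; have dN : mdet N != 0 by rewrite -(mprop_det MN).
have dMx : mdet (mmul M (lmatrix x)) != 0 by rewrite mdetM mulf_neq0 ?lmatrix_det.
have dNx : mdet (mmul N (lmatrix x)) != 0 by rewrite mdetM mulf_neq0 ?lmatrix_det.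
apply/lclass_eq => //; rewrite (mdist_propl dMx dNx (N := mmul N (lmatrix x))).
  by rewrite mdist_refl.
by apply: mprop_mul MN (mprop_refl _).
Qed.

Lemma mact1 x : mact (m1 D) x = x.
Proof. by rewrite /mact mmul1 lclassK. Qed.

Lemma mact_adj M x y : mdet M != 0 -> ladj (mact M x) (mact M y) = ladj x y.
Proof.
move=> dM; rewrite /ladj mdist_class ?mdetM ?mulf_neq0 ?lmatrix_det //.
by rewrite mdist_mull ?lmatrix_det.
Qed.

(** At a fixed vertex [M] is conjugate to a scalar times an element of GL_2(O), and an integral
    matrix with unit determinant is not hyperbolic. *)
Lemma mact_fix M x : mdet M != 0 -> mact M x = x -> ~ hyperbolic_mat M.
Proof.
move=> dM; rewrite -{2}[x]lclassK; set g := lmatrix x.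
have dg : mdet g != 0 by exact: lmatrix_det.
have dMg : mdet (mmul M g) != 0 by rewrite mdetM mulf_neq0.
move/(lclass_eq dMg dg); rewrite mdist_sym // => /delta0P[].
  by rewrite mdetM mdet_adj mulf_neq0.
move=> k [U [k0 rU e]] hM.
have dg' : mdet (madj g) != 0 by rewrite mdet_adj.
have := hyp_conj dg' dM hM; rewrite madjK -mmulA e hyp_scale //.
  by move=> [_]; rewrite [X in (_ < X)%N]ps_res_val.
by apply: contraNneq rU => ->; rewrite rmorph0.
Qed.

Lemma mval_leq_entries (a b c d : D) : mdet (a, b, c, d) != 0 ->
  (b != 0 -> (mval (a, b, c, d) <= v b)%N) /\
  (c != 0 -> (mval (a, b, c, d) <= v c)%N).
Proof.
move=> /mval_split[[[[a' b'] c'] d'] _ /= [_ bE cE _]].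
by split=> [b0|c0]; [apply: ps_val_dvd bE | apply: ps_val_dvd cE].
Qed.

(** For g = diag(t^n, 1), the matrix adj(g) M g still has the entry [b], but its determinant is
    multiplied by t^(2n). As the vertex of g is fixed, the valuation of that determinant is at most
    2 v(b) if [b] is nonzero, which fails for n = v(b) + 1. For [c], diag(1, t^n) serves. *)
Lemma fix_diag (a b c d : D) : mdet (a, b, c, d) != 0 ->
  (forall x, mact (a, b, c, d) x = x) -> b = 0 /\ c = 0.
Proof.
set M := (a, b, c, d) => dM M_fix; have t0 := ps_t_neq0 'F_3.
have fix_mval g : mdet g != 0 ->
    (v (mdet g * mdet M * mdet g)%R <= (mval (mmul (mmul (madj g) M) g)).*2)%N.
  move=> dg; have := M_fix (lclass g); rewrite mact_class // => /esym/lclass_eq.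
  rewrite mdetM mulf_neq0 // => /(_ dg isT)/eqP.
  by rewrite /mdist mmulA /delta !mdetM mdet_adj subn_eq0.
have tn0 n : t ^+ n != 0 by rewrite expf_neq0.
split; apply/eqP/negPn/negP => nz.
- pose g n := mdiag (t ^+ n) 1; have gdet n : mdet (g n) = t ^+ n by rewrite /=; ring.
  have := fix_mval (g (v b).+1); rewrite gdet => /(_ (tn0 _)).
  have -> : mmul (mmul (madj (g (v b).+1)) M) (g (v b).+1) =
      (t ^+ (v b).+1 * a, b, t ^+ (v b).+1 ^+ 2 * c, t ^+ (v b).+1 * d).
    by rewrite /M /g /mdiag /=; congr (_, _, _, _); ring.
  set N := (_, _, _, _); have dN : mdet N != 0.
    rewrite (_ : mdet N = t ^+ (v b).+1 ^+ 2 * mdet M) ?mulf_neq0 //.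
    by rewrite /N /M /=; ring.
  have /(_ nz) := (mval_leq_entries dN).1.
  by rewrite -/N !ps_valM ?mulf_neq0 // !ps_valX // !ps_val_t; lia.
- pose g n := mdiag 1 (t ^+ n); have gdet n : mdet (g n) = t ^+ n by rewrite /=; ring.
  have := fix_mval (g (v c).+1); rewrite gdet => /(_ (tn0 _)).
  have -> : mmul (mmul (madj (g (v c).+1)) M) (g (v c).+1) =
      (t ^+ (v c).+1 * a, t ^+ (v c).+1 ^+ 2 * b, c, t ^+ (v c).+1 * d).
    by rewrite /M /g /mdiag /=; congr (_, _, _, _); ring.
  set N := (_, _, _, _); have dN : mdet N != 0.
    rewrite (_ : mdet N = t ^+ (v c).+1 ^+ 2 * mdet M) ?mulf_neq0 //.
    by rewrite /N /M /=; ring.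
  have /(_ nz) := (mval_leq_entries dN).2.
  by rewrite -/N !ps_valM ?mulf_neq0 // !ps_valX // !ps_val_t; lia.
Qed.

Lemma mact_faithful M : mdet M != 0 -> (forall x, mact M x = x) -> mscalar M.
Proof.
move=> dM M_fix; case: M => [[[a b] c] d] in dM M_fix *.
have [b0 c0] := fix_diag dM M_fix.
(* Conjugation by a unipotent puts the difference of the diagonal entries off the diagonal, where
   [fix_diag] kills it. *)
pose g : mat2 D := (1, 1, 0, 1).
have dg : mdet g = 1 by rewrite /=; ring.
have dgM : mdet (mmul (mmul (madj g) (a, b, c, d)) g) != 0.
  by rewrite !mdetM mdet_adj dg mul1r mulr1.
have g_fix x : mact (mmul (mmul (madj g) (a, b, c, d)) g) x = x.
  rewrite !mactM ?mdetM ?mdet_adj ?mulf_neq0 ?dg ?oner_neq0 // M_fix.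
  rewrite -mactM ?mdet_adj ?dg ?oner_neq0 // madj_mul dg mscale1; exact: mact1.
have e : mmul (mmul (madj g) (a, b, c, d)) g = (a - c, a - c + b - d, c, c + d).
  by rewrite /g /=; congr (_, _, _, _); ring.
rewrite e in dgM g_fix; have [+ _] := fix_diag dgM g_fix.
by rewrite b0 c0 subr0 addr0 => /eqP; rewrite subr_eq0 => /eqP.
Qed.

End LatticeTree.

(** * Words in the free group *)

Section FreeWords.

Local Notation D := (pseries 'F_3).
Local Notation t := (ps_t 'F_3).
Local Notation v := (@ps_val 'F_3).
Local Notation res := (@ps_res 'F_3).
Local Notation wm := (wmat gmat).
Local Notation word := (seq (bool * bool)).

Definition feq : word -> word -> Prop := @word_eq bool (fun=> False).

Implicit Types u w : word.

Lemma wm_feq u w : feq u w -> mprop (wm u) (wm w).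
Proof. by move=> uw; apply: (wmat_word_eq gmat_det) uw. Qed.

Lemma not_path_split (T : Type) (e : rel T) x p : ~~ path e x p ->
  exists s a b q, x :: p = s ++ [:: a, b & q] /\ ~~ e a b.
Proof.
elim: p x => [|y p IHp] x //=; rewrite negb_and; case/orP => [xy|/IHp].
  by exists [::], x, y, p.
by case=> s [a [b [q [-> ab]]]]; exists (x :: s), a, b, q.
Qed.

(** Deleting an adjacent cancelling pair, or conjugating away first and last letters that cancel,
    shortens the word. *)
Lemma cyclic_reduction w : exists g w',
  feq w (g ++ w' ++ word_inv g) /\ cycle ncancel w'.
Proof.
have [n] := ubnP (size w); elim: n w => // n IHn [|l p] size_w.
  by exists [::], [::]; split=> //; apply: word_eq_refl.
have [lp|nlp] := boolP (path ncancel l p); last first.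
  have [s [a [b [q [e]]]]] := not_path_split nlp.
  rewrite negbK => /eqP bE.
  have [|g [w' [gw cyc]]] := IHn (s ++ q).
    by move: size_w; rewrite e !size_cat /=; lia.
  exists g, w'; split=> //; apply: word_eq_trans gw; rewrite e.
  apply: word_eq_catl; rewrite -[X in word_eq _ _ X]cat0s -(cat1s a) -(cat1s b) catA.
  by apply: word_eq_catr; rewrite bE; case: (a) => x y; apply: word_eq_cancel.
have [c|] := boolP (ncancel (last l p) l).
  exists [::], (l :: p); split; first by rewrite cats0; apply: word_eq_refl.
  by rewrite /cycle rcons_path lp.
case: (lastP p) => [|p' x] in lp size_w *; first by case: l {lp size_w} => [[] []].
rewrite last_rcons negbK => /eqP lE.
have [|g [w' [gw cyc]]] := IHn p'.
  by move: size_w; rewrite /= size_rcons; lia.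
exists ((l : bool * bool) :: g), w'; split=> //.
have xE : x = (l.1, ~~ l.2) by rewrite lE; case: (x) => ? ? /=; rewrite negbK.
rewrite -[l :: g]cat1s word_inv_cat -cats1 -cat1s -!catA.
apply: word_eq_catl; rewrite !catA; apply: word_eq_cat.
  by rewrite -catA.
by rewrite /word_inv /= xE; apply: word_eq_refl.
Qed.

Lemma free_hyp w : feq w [::] \/ hyperbolic_mat (wm w).
Proof.
have [g [w' [e cyc]]] := cyclic_reduction w.
have [w0|wn] := eqVneq w' [::].
  left; apply: word_eq_trans e _; rewrite w0 /=; exact: word_mulV.
right; apply: (hyp_prop _ (mprop_sym (wm_feq e))); first exact/wmat_det/gmat_det.
rewrite !wmat_cat wmat_inv mmulA.
by apply: hyp_conj (cycle_hyp wn cyc); apply/wmat_det/gmat_det.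
Qed.

Definition comm_word : word :=
  [:: (false, false); (true, false); (false, true); (true, true)].

Lemma wm_comm : exists2 k, k != 0 & wm comm_word = mscale k (mdiag 1 (t ^+ 4)).
Proof.
(* Up to sign, the product of the unit parts of the determinants of the two generators; its residue
   is 2. *)
exists ((1 - t) * (2%:R + t + t ^+ 2)).
  apply/eqP => /(congr1 res)/eqP.
  by rewrite rmorph0 rmorphM !rmorphD !rmorphN rmorphXn.
rewrite /wmat /lmat /mdiag /m1 /=; congr (_, _, _, _); ring.
Qed.

Definition comm_pow (b : bool) n : word :=
  wpow n (if b then word_inv comm_word else comm_word).

Lemma wm_comm_pow b n : mprop (wm (comm_pow b n))
  (if b then mdiag (t ^+ (4 * n)) 1 else mdiag 1 (t ^+ (4 * n))).
Proof.
have [k k0 e] := wm_comm.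
elim: n => [|n IHn].
  by rewrite /comm_pow /= /mdiag muln0 expr0; case: b; apply: mprop_refl.
rewrite /comm_pow wpowSr wmat_cat -/(comm_pow b n).
apply: (mprop_trans (mprop_mul IHn (mprop_refl _))).
have -> : wm (if b then word_inv comm_word else comm_word) =
    mscale k (if b then mdiag (t ^+ 4) 1 else mdiag 1 (t ^+ 4)).
  case: b {IHn} => //; rewrite wmat_inv e madj_scale; congr mscale.
  by rewrite /mdiag /=; congr (_, _, _, _); ring.
rewrite mscaler; apply: (mprop_trans (mprop_scale _ k0)).
rewrite [(4 * n.+1)%N]mulnS addnC exprD.
suff -> : mmul (if b then mdiag (t ^+ (4 * n)) 1 else mdiag 1 (t ^+ (4 * n)))
    (if b then mdiag (t ^+ 4) 1 else mdiag 1 (t ^+ 4)) =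
  if b then mdiag (t ^+ (4 * n) * t ^+ 4) 1 else mdiag 1 (t ^+ (4 * n) * t ^+ 4).
  exact: mprop_refl.
by case: b {IHn}; rewrite /mdiag /=; congr (_, _, _, _); ring.
Qed.

Lemma comm_pow_inv b n : word_inv (comm_pow b n) = comm_pow (~~ b) n.
Proof. by case: b; rewrite /comm_pow word_inv_pow ?word_invK. Qed.

(** Right multiplication in the integer Heisenberg group: [p] and [q] are the exponent sums of the
    generators, [r] is the central coordinate, equal to 1 on [comm_word]. *)
Definition heis_step (s : int * int * int) (l : bool * bool) : int * int * int :=
  let: (p, q, r) := s in
  match l with
  | (false, false) => (p + 1, q, r) | (false, true) => (p - 1, q, r)
  | (true, false) => (p, q + 1, r + p) | (true, true) => (p, q - 1, r - p)
  end.

Notation heis := (foldl heis_step (0, 0, 0)).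

Lemma heis_feq u w : feq u w -> heis u = heis w.
Proof.
move=> uw; apply: (foldl_word_eq _ _ uw) => // x b [[p q] r].
by case: x b => [] [] /=; congr (_, _, _); ring.
Qed.

Lemma heis_cat u w p q r p' q' r' : heis u = (p, q, r) -> heis w = (p', q', r') ->
  heis (u ++ w) = (p + p', q + q', r + r' + p * q').
Proof.
rewrite foldl_cat => ->; elim/last_ind: w p' q' r' => [|w l IHw] p' q' r'.
  by case=> <- <- <-; congr (_, _, _); ring.
rewrite !foldl_rcons; case: (heis w) IHw => [[x y] z] /(_ x y z erefl) -> /=.
by case: l => [[] []] [] <- <- <-; congr (_, _, _); ring.
Qed.

Lemma heis_comm_pow b n : heis (comm_pow b n) = (0, 0, if b then - n%:Z else n%:Z).
Proof.
elim: n => [|n IHn]; first by case: b.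
have step : heis (if b then word_inv comm_word else comm_word) =
    (0, 0, if b then -1 else 1) by case: b {IHn}.
rewrite /comm_pow wpowSr (heis_cat IHn step); case: b {IHn step};
  by congr (_, _, _); rewrite ?intS; ring.
Qed.

Lemma pair4_inj (T : Type) (a b c d a' b' c' d' : T) :
  (a, b, c, d) = (a', b', c', d') -> [/\ a = a', b = b', c = c' & d = d'].
Proof. by case. Qed.

(** Triangular matrices, upper ones if [b] is false, with v(x) - v(w) = i - j written without
    subtraction. This difference is additive under products and unchanged by scalars. *)
Definition tri_val (b : bool) (M : mat2 D) (i j : nat) : Prop :=
  let: (x, y, z, w) := M in (if b then y else z) = 0 /\ (v x + j = v w + i)%N.

Lemma tri_diag_neq0 b (x y z w : D) : mdet (x, y, z, w) != 0 ->
  (if b then y else z) = 0 -> x != 0 /\ w != 0.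
Proof.
move=> /= dM yz; have e : y * z = 0 by case: b yz => ->; rewrite ?mul0r ?mulr0.
by apply/andP; rewrite e subr0 mulf_eq0 negb_or in dM.
Qed.

Lemma tri_valM b M N i j i' j' : mdet M != 0 -> mdet N != 0 ->
  tri_val b M i j -> tri_val b N i' j' -> tri_val b (mmul M N) (i + i') (j + j').
Proof.
move: M N => [[[x y] z] w] [[[x' y'] z'] w'] dM dN [yz e] [yz' e'].
have [x0 w0] := tri_diag_neq0 dM yz; have [x0' w0'] := tri_diag_neq0 dN yz'.
by case: b yz yz' => yz yz'; rewrite /tri_val /= yz yz' ?mulr0 ?mul0r ?addr0 ?add0r
  !ps_valM //; split=> //; lia.
Qed.

Lemma tri_val_prop b M N i j : mdet M != 0 -> mprop M N ->
  tri_val b M i j -> tri_val b N i j.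
Proof.
move=> dM MN; have dN : mdet N != 0 by rewrite -(mprop_det MN).
case: MN => k [l [k0 l0]].
move: M N dM dN => [[[x y] z] w] [[[x' y'] z'] w'] dM dN e4 [yz e].
have [ex ey ez ew] := pair4_inj e4.
have [x0 w0] := tri_diag_neq0 dM yz.
have yz' : (if b then y' else z') = 0.
  case: b yz => yz; apply: (mulfI l0); rewrite mulr0.
    by rewrite -ey yz mulr0.
  by rewrite -ez yz mulr0.
have [x0' w0'] := tri_diag_neq0 dN yz'; split=> //.
by move/(congr1 v): ex; move/(congr1 v): ew; rewrite !ps_valM //; lia.
Qed.

Lemma tri_val_feq b u i : tri_val b (wm u) i i -> feq u [::].
Proof.
have := wmat_det gmat_det u; case: (free_hyp u) => //.
case: (wm u) => [[[x y] z] w] hM dM [yz /addIn vxw]; have [x0 w0] := tri_diag_neq0 dM yz.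
by case: (triangular_nhyp _ x0 w0 vxw hM); case: b yz => /= ->; rewrite eqxx ?orbT.
Qed.

Lemma tri_val_comm_pow b b' n :
  tri_val b (wm (comm_pow b' n)) (if b' then 4 * n else 0)%N (if b' then 0 else 4 * n)%N.
Proof.
have t0 := ps_t_neq0 'F_3.
have dn m : v (t ^+ m) = m by rewrite ps_valX // ps_val_t muln1.
have v1 : v 1 = 0%N by rewrite ps_res_val // rmorph1.
apply: (tri_val_prop _ (mprop_sym (wm_comm_pow b' n))).
  case: b' => /=; rewrite mul0r subr0 ?mulr1 ?mul1r expf_neq0 //.
by case: b b' => [] []; rewrite /tri_val /mdiag /= dn v1; split=> //; lia.
Qed.

Lemma tri_val_pow4 b u i j : tri_val b (wm u) i j ->
  tri_val b (wm (u ++ u ++ u ++ u)) (4 * i) (4 * j).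
Proof.
move=> uij; rewrite !wmat_cat !mulSn !mul0n !addn0.
by do !apply: tri_valM => //; rewrite ?mdetM ?mulf_neq0 //; apply/wmat_det/gmat_det.
Qed.

(* The product of u^4 and a power of c has diagonal entries of equal          *)
(* valuations, so it is trivial. In the Heisenberg group, where c generates   *)
(* the centre, this forces the exponent of c to be divisible by 4.            *)
Lemma tri_val_comm b u i j : tri_val b (wm u) i j -> exists b' n, feq u (comm_pow b' n).
Proof.
(* Below, [m] is the absolute value of i - j and [b'] selects the sign of the exponent. The diagonal
   valuations of c differ by 4, so those of u^4 differ as for a power of c with exponent [m] or its
   opposite. *)
move=> uij; have dw := wmat_det gmat_det.
have du4 : mdet (wm (u ++ u ++ u ++ u)) != 0 by exact: dw.
pose b' := (j <= i)%N; pose m := ((i - j) + (j - i))%N.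
have u4 : feq (u ++ u ++ u ++ u) (comm_pow b' m).
  apply: word_eq_cancelV; rewrite comm_pow_inv.
  apply: (@tri_val_feq b _ (4 * maxn i j)); rewrite wmat_cat.
  have := tri_valM (dw _) (dw _) (tri_val_pow4 uij) (tri_val_comm_pow b (~~ b') m).
  have -> : (4 * i + (if ~~ b' then 4 * m else 0) = 4 * maxn i j)%N.
    by rewrite /b' /m; case: leqP => /= ij; lia.
  have -> // : (4 * j + (if ~~ b' then 0 else 4 * m) = 4 * maxn i j)%N.
  by rewrite /b' /m; case: leqP => /= ij; lia.
case u_heis: (heis u) => [[p q] r].
have := heis_feq u4.
rewrite heis_comm_pow.
rewrite (heis_cat u_heis (heis_cat u_heis (heis_cat u_heis u_heis))).
case=> p0 q0 r0; have {p0}p0: p = 0 by lia.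
have {q0}q0: q = 0 by lia.
subst p q; rewrite !mul0r in r0.
exists b', `|r|%N; apply: word_eq_cancelV; rewrite comm_pow_inv.
have r_m : (m = 4 * `|r|)%N by move: r0; case: (b') => /=; lia.
apply: (@tri_val_feq b _ (maxn i j)); rewrite wmat_cat.
have := tri_valM (dw _) (dw _) uij (tri_val_comm_pow b (~~ b') `|r|).
rewrite -r_m.
have -> : (i + (if ~~ b' then m else 0) = maxn i j)%N.
  by rewrite /b' /m; case: leqP => /= ij; lia.
have -> // : (j + (if ~~ b' then 0 else m) = maxn i j)%N.
by rewrite /b' /m; case: leqP => /= ij; lia.
Qed.

End FreeWords.

(** * The double of the free group *)

Section Double.

Local Notation D := (pseries 'F_3).
Local Notation t := (ps_t 'F_3).
Local Notation v := (@ps_val 'F_3).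
Local Notation res := (@ps_res 'F_3).
Local Notation wm := (wmat gmat).
Local Notation word := (seq (bool * bool)).
Local Notation dword := (seq ((bool * bool) * bool)).

Definition side (s : bool) (u : word) : dword := [seq ((s, l.1), l.2) | l <- u].

Definition double_word : dword :=
  side false comm_word ++ word_inv (side true comm_word).

Definition deq : dword -> dword -> Prop := @word_eq (bool * bool)%type (fun w => w = double_word).

Lemma side_cat s u w : side s (u ++ w) = side s u ++ side s w.
Proof. exact: map_cat. Qed.

Lemma side_inv s u : side s (word_inv u) = word_inv (side s u).
Proof. by rewrite /side /word_inv map_rev -!map_comp. Qed.

Lemma side_feq s u w : feq u w -> deq (side s u) (side s w).
Proof.
elim=> {u w} [u|u w _|u x w _ uv _|u u' w w' _ uu' _ vv'|x b|//].
- exact: word_eq_refl.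
- exact: word_eq_sym.
- exact: word_eq_trans.
- by rewrite !side_cat; apply: word_eq_cat.
- exact: word_eq_cancel.
Qed.

Lemma side_comm_pow b n : deq (side false (comm_pow b n)) (side true (comm_pow b n)).
Proof.
have e1 : deq (side false comm_word) (side true comm_word).
  by apply: word_eq_cancelV; apply: word_eq_rel.
elim: n => [|n IHn]; first exact: word_eq_refl.
rewrite /comm_pow wpowSr -/(comm_pow b n) !side_cat; apply: word_eq_cat => //.
by case: b {IHn} => //; rewrite !side_inv; apply: word_eq_inv.
Qed.

Definition is_comm u := exists b n, feq u (comm_pow b n).

Lemma side_is_comm s s' u : is_comm u -> exists u', deq (side s u) (side s' u').
Proof.
case=> b [n e]; exists (comm_pow b n); apply: word_eq_trans (side_feq s e) _.
case: s s' => [] []; try exact: word_eq_refl; last exact: side_comm_pow.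
exact/word_eq_sym/side_comm_pow.
Qed.

Definition dconj (x y : dword) := exists g, deq x (g ++ y ++ word_inv g).

Lemma dconj_eq x y : deq x y -> dconj x y.
Proof. by exists [::]; rewrite cats0. Qed.

Lemma dconj_trans y x z : dconj x y -> dconj y z -> dconj x z.
Proof.
case=> g xy [h yz]; exists (g ++ h); apply: word_eq_trans xy _.
have -> : (g ++ h) ++ z ++ word_inv (g ++ h) = g ++ (h ++ z ++ word_inv h) ++ word_inv g.
  by rewrite word_inv_cat -!catA.
exact/word_eq_catl/word_eq_catr.
Qed.

Lemma dconj_rot x y : dconj (x ++ y) (y ++ x).
Proof.
exists x; have -> : x ++ (y ++ x) ++ word_inv x = (x ++ y) ++ x ++ word_inv x.
  by rewrite -!catA.
rewrite -{1}[x ++ y]cats0; exact/word_eq_catl/word_eq_sym/word_mulV.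
Qed.

Definition syllables (L : seq (bool * word)) : dword :=
  flatten [seq side p.1 p.2 | p <- L].

Lemma syllables_cat L L' : syllables (L ++ L') = syllables L ++ syllables L'.
Proof. by rewrite /syllables map_cat flatten_cat. Qed.

Lemma syllables_onto (x : dword) : exists L, syllables L = x.
Proof.
exists [seq (l.1.1, [:: (l.1.2, l.2)]) | l <- x].
by elim: x => [|[[s g] b] x IHx] //=; rewrite /syllables /= -/(syllables _) IHx.
Qed.

Definition pair_word (ps : seq (word * word)) : dword :=
  flatten [seq side false p.1 ++ side true p.2 | p <- ps].

Definition reduced_pairs (ps : seq (word * word)) : Prop :=
  forall p, p \in ps -> ~ is_comm p.1 /\ ~ is_comm p.2.

Definition normal (x : dword) : Prop :=
  [\/ x = [::], exists s u, x = side s u /\ hyperbolic_mat (wm u)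
    | exists ps, [/\ ps != [::], x = pair_word ps & reduced_pairs ps]].

(** Where this fails for cyclic neighbours they merge: both lie in one factor, or the first lies in
    the amalgamated subgroup and can change sides. *)
Definition next_ok (p q : bool * word) : bool := (p.1 != q.1) && ~~ `[< is_comm p.2 >].

Lemma not_cycle_rot (T : Type) (e : rel T) (s : seq T) : (1 < size s)%N -> ~~ cycle e s ->
  exists s1 s2 a b r, [/\ s = s1 ++ s2, s2 ++ s1 = [:: a, b & r] & ~~ e a b].
Proof.
case: s => [|x p] // size_p; rewrite /cycle => nP.
have [s [a [b [q [E nab]]]]] := not_path_split nP.
case/lastP: q E => [|q y] E.
  have E' : rcons (x :: p) x = rcons (rcons s a) b.
    by rewrite [LHS]E -!cats1 -catA.
  have [E1 E2] := rcons_inj E'; subst b; case: s E E' E1 => [|x' s] E E' E1.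
    by rewrite E1 in size_p.
  case: E1 => -> ps; exists (x' :: s), [:: a], a, x', s; split => //.
    by rewrite ps cats1.
  by case: E => <-.
have E' : rcons (x :: p) x = rcons (s ++ [:: a, b & q]) y.
  by rewrite [LHS]E rcons_cat.
have [E1 _] := rcons_inj E'.
by exists s, [:: a, b & q], a, b, (q ++ s).
Qed.

(** The dummy syllable [(true, u0)] makes a nonempty [L] start on side [false]; as it ends on side
    [true], its syllables pair up. *)
Lemma alternating_pairs L u0 : path (fun p q : bool * word => p.1 != q.1) (true, u0) L ->
    (last (true, u0) L).1 -> (forall p, p \in L -> ~ is_comm p.2) ->
  exists ps, [/\ syllables L = pair_word ps, reduced_pairs ps & size L = (size ps).*2].
Proof.
have [n] := ubnP (size L); elim: n L u0 => // n IHn.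
case=> [|[[] u] [|[[] w] L]] u0 size_L //=; first by exists [::].
move=> L_alt L_last L_nc.
have [|||p pL|ps [e red size_ps]] := IHn L w.
- by move: size_L => /=; lia.
- exact: L_alt.
- exact: L_last.
- by apply: L_nc; rewrite !inE pL !orbT.
exists ((u, w) :: ps); split; last by rewrite size_ps.
  by rewrite /syllables /pair_word /= -/(syllables L) e -!catA.
move=> p; rewrite inE => /predU1P[->|/red//]; split.
  by apply: (L_nc (false, u)); rewrite mem_head.
by apply: (L_nc (true, w)); rewrite !inE eqxx orbT.
Qed.

Lemma cycle_next_ok L : (1 < size L)%N -> cycle next_ok L ->
  exists2 x, dconj (syllables L) x & normal x.
Proof.
have alt p q : next_ok p q -> p.1 != q.1 by case/andP.
have all_nc r z s : path next_ok r s -> next_ok (last r s) z ->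
    all (fun p : bool * word => ~~ `[< is_comm p.2 >]) (r :: s).
  elim: s r => [|q s IHs] r /=; first by move=> _ /andP[_ ->].
  by move=> /andP[/andP[_ ->] qs] /(IHs _ qs).
have false_case L' : (0 < size L')%N -> ~~ (head (true, [::]) L').1 -> cycle next_ok L' ->
    normal (syllables L').
  case: L' => [|[[] u] L'] // _ _; rewrite /cycle rcons_path => /andP[p_ok last_ok].
  have [||p|ps [e red size_ps]] := @alternating_pairs ((false, u) :: L') [::].
  - by rewrite /=; apply: sub_path p_ok.
  - by move/alt: last_ok => /=; case: (last _ _).1.
  - move=> pL.
    by move/allP/(_ p pL)/asboolPn: (all_nc _ _ _ p_ok last_ok).
  by apply: Or33; exists ps; split=> //; case: ps size_ps {e red}.
move=> size_L cyc; have [h|h] := boolP ((head (true, [::]) L).1); last first.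
  by exists (syllables L); [apply/dconj_eq/word_eq_refl | apply: false_case => //; lia].
(* Rotation by one syllable is a conjugation and puts side [false] first. *)
exists (syllables (rot 1 L)); last first.
  apply: false_case; rewrite ?rot_cycle ?size_rot //; first by lia.
  case: L size_L cyc h => [|p [|q L]] //= _ /andP[/alt pq _] p1.
  by rewrite /rot /=; move: pq; rewrite p1; case: (q.1).
by rewrite -{1}(cat_take_drop 1 L) !syllables_cat; apply: dconj_rot.
Qed.

(** Induction on the number of syllables: a cyclic pair violating [next_ok] is rotated to the front
    and merged into one syllable. *)
Lemma normal_form (x : dword) : exists2 y, dconj x y & normal y.
Proof.
have [L <-] := syllables_onto x.
have [n] := ubnP (size L); elim: n L => // n IHn L size_L.
case: L size_L => [|[s u] [|q L]] size_L.
- by exists [::]; [apply/dconj_eq/word_eq_refl | apply: Or31].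
- rewrite /syllables /= cats0; have [u1|hu] := free_hyp u.
    by exists [::]; [apply/dconj_eq/(side_feq s u1) | apply: Or31].
  by exists (side s u); [apply/dconj_eq/word_eq_refl | apply: Or32; exists s, u].
have [|] := boolP (cycle next_ok [:: (s, u), q & L]); first exact: cycle_next_ok.
move=> nL; have [L1 [L2 [a [b [r [LE rE nab]]]]]] :=
  @not_cycle_rot _ _ [:: (s, u), q & L] isT nL.
have size_r : (size r < n.-1)%N.
  have := congr1 size rE; rewrite size_cat addnC -size_cat -LE /=.
  by move: size_L => /=; lia.
have [w abw] : exists w, deq (side a.1 a.2 ++ side b.1 b.2) (side b.1 w).
  move: nab; rewrite negb_and !negbK => /orP[/eqP ->|/asboolP/(side_is_comm a.1 b.1)].
    by exists (a.2 ++ b.2); rewrite side_cat; apply: word_eq_refl.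
  by case=> w aw; exists (w ++ b.2); rewrite side_cat; apply: word_eq_catr.
have [|y wy ny] := IHn ((b.1, w) :: r); first by rewrite /=; lia.
exists y => //; apply: dconj_trans wy.
rewrite LE syllables_cat; apply: dconj_trans (dconj_rot _ _) _.
rewrite -syllables_cat rE; apply: dconj_eq; rewrite /syllables /= catA.
exact: word_eq_catr.
Qed.

End Double.

(** * Generic parameters *)

Section PairProducts.

Variable R : comNzRingType.

Implicit Types ps : seq (mat2 R * mat2 R).

(** As [mdiag z 1] is the adjugate of [mdiag 1 z], the second matrix of each pair enters conjugated
    up to a scalar, and the entries stay polynomial in [z]. *)
Definition pair_mat (z : R) ps : mat2 R :=
  foldr (fun p => mmul (mmul (mmul p.1 (mdiag 1 z)) (mmul p.2 (mdiag z 1)))) (m1 R) ps.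

Lemma pair_mat_cons z p ps : pair_mat z (p :: ps) =
  mmul (mmul (mmul p.1 (mdiag 1 z)) (mmul p.2 (mdiag z 1))) (pair_mat z ps).
Proof. by []. Qed.

End PairProducts.

Lemma mmap_pair_mat (R S : comNzRingType) (f : {rmorphism R -> S}) z ps :
  mmap f (pair_mat z ps) = pair_mat (f z) [seq (mmap f p.1, mmap f p.2) | p <- ps].
Proof.
elim: ps => [|p ps IHps]; first exact: mmap1.
by rewrite !pair_mat_cons !mmap_mul IHps /mdiag /= !rmorph1 !rmorph0.
Qed.

Section PairDomain.

Variable D : idomainType.

Implicit Types ps : seq (mat2 D * mat2 D).

(** The projections are the lower left entry of the first matrix and the upper right entry of the
    second; their product is the lower right entry of the block at z = 0. *)
Definition twisted_pair (p : mat2 D * mat2 D) : Prop :=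
  p.1.1.2 != 0 /\ p.2.1.1.2 != 0.

Lemma pair_mat0 ps : ps != [::] -> (forall p, p \in ps -> twisted_pair p) ->
  exists2 y, y.2 != 0 & pair_mat 0 ps = (0, y.1, 0, y.2).
Proof.
have block (p : mat2 D * mat2 D) : exists x, mmul (mmul p.1 (mdiag 1 0)) (mmul p.2 (mdiag 0 1)) =
    (0, x, 0, p.1.1.2 * p.2.1.1.2).
  case: p => [[[[a b] c] d] [[[a' b'] c'] d']]; exists (a * b'); rewrite /mdiag /=.
  by congr (_, _, _, _); ring.
elim: ps => // p ps IHps _ ps_tw.
have [x e] := block p; have [p1 p2] := ps_tw p (mem_head _ _).
have [->|nps] := eqVneq ps [::].
  by exists (x, p.1.1.2 * p.2.1.1.2); [rewrite /= mulf_neq0 | rewrite /pair_mat /= mmulr1 e].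
have [|y y0 ey] := IHps nps; first by move=> q qs; apply: ps_tw; rewrite inE qs orbT.
exists (x * y.2, p.1.1.2 * p.2.1.1.2 * y.2); first by rewrite /= !mulf_neq0.
by rewrite pair_mat_cons e ey /=; congr (_, _, _, _); ring.
Qed.

Lemma mdet_pair_mat z ps : ps != [::] -> exists k, mdet (pair_mat z ps) = z ^+ 2 * k.
Proof.
case: ps => // p ps _; exists (mdet p.1 * mdet p.2 * mdet (pair_mat z ps)).
by rewrite pair_mat_cons !mdetM /mdiag /=; ring.
Qed.

Definition pair_poly ps : mat2 {poly D} :=
  pair_mat 'X [seq (mmap polyC p.1, mmap polyC p.2) | p <- ps].

Lemma mmap_horner_pair_poly z ps : mmap (horner_eval z) (pair_poly ps) = pair_mat z ps.
Proof.
rewrite mmap_pair_mat /= /horner_eval hornerX -map_comp; congr pair_mat.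
rewrite -[RHS]map_id; apply: eq_map => -[[[[a b] c] d] [[[a' b'] c'] d']] /=.
by rewrite !hornerC.
Qed.

Definition pair_gap ps : {poly D} := let: (a, b, c, d) := pair_poly ps in d - a.

(** The value at 0 is the nonzero lower right entry from [pair_mat0]. *)
Lemma pair_gap_neq0 ps : ps != [::] -> (forall p, p \in ps -> twisted_pair p) ->
  pair_gap ps != 0.
Proof.
move=> nps /(pair_mat0 nps)[y y0]; rewrite -mmap_horner_pair_poly /pair_gap.
case: (pair_poly ps) => [[[a b] c] d] /=; rewrite /horner_eval => e.
have [a0 _ _ d0] := pair4_inj e.
apply: contraNneq y0 => /(congr1 (fun p : {poly D} => p.[0])).
by rewrite hornerD hornerN a0 d0 subr0 horner0 => ->.
Qed.

Lemma pair_mat_nscalar z ps : (pair_gap ps).[z] != 0 -> ~ mscalar (pair_mat z ps).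
Proof.
rewrite -mmap_horner_pair_poly /pair_gap.
case: (pair_poly ps) => [[[a b] c] d] /=; rewrite /horner_eval hornerD hornerN => gap [_ _ ad].
by move: gap; rewrite ad subrr eqxx.
Qed.

Lemma horner_mod (p : {poly D}) z : exists k, p.[z] = p.[0] + z * k.
Proof.
have /factor_theorem[q e] : root (p - p.[0]%:P) 0.
  by rewrite /root hornerD hornerN hornerC subrr.
exists q.[z]; apply/eqP; rewrite -subr_eq0 opprD addrA subr_eq0; apply/eqP.
have /(congr1 (fun p : {poly D} => p.[z])) := e.
by rewrite hornerD hornerN hornerC hornerM hornerD hornerX hornerN hornerC subr0 mulrC.
Qed.

Lemma pair_mat_tr ps : ps != [::] -> (forall p, p \in ps -> twisted_pair p) ->
  exists2 y, y != 0 & forall z, exists k, mtr (pair_mat z ps) = y + z * k.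
Proof.
move=> nps /(pair_mat0 nps)[y y0 e]; exists y.2 => // z.
have [k ek] := horner_mod (mtr (pair_poly ps)) z; exists k.
move: ek; rewrite -!horner_evalE -!mmap_tr !mmap_horner_pair_poly e /= add0r.
by [].
Qed.

Lemma poly_roots (p : {poly D}) : p != 0 ->
  exists rs : seq D, forall z, root p z -> z \in rs.
Proof.
have [n] := ubnP (size p); elim: n p => // n IHn p size_p p0.
have [[z pz]|nroot] := pselect (exists z, root p z); last first.
  by exists [::] => z pz; case: nroot; exists z.
have /factor_theorem[q e] := pz.
have q0 : q != 0 by apply: contraNneq p0 => q0; rewrite e q0 mul0r.
have [||rs rsP] := IHn q => //.
  by move: size_p; rewrite e size_mul ?polyXsubC_eq0 // size_XsubC addn2.
exists (z :: rs) => x; rewrite e rootM root_XsubC inE orbC.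
by case/orP=> [->//|/rsP->]; rewrite orbT.
Qed.

End PairDomain.

(** * Parameters outside a countable set *)

Section Generic.

Local Notation D := (pseries 'F_3).
Local Notation t := (ps_t 'F_3).

Lemma avoid_seq (r : nat -> D) m :
  exists2 s : D, ps_res s = 1 & forall n, t ^+ m * s != r n.
Proof.
(* Cantor's diagonal: coefficient n + 1 of the series differs from coefficient m + n + 1 of [r n],
   and coefficient 0 is kept for the residue. *)
exists (PSeries (fun i => if i is n.+1 then coefs (r n) (m + n.+1) + 1 else 1)) => // n.
apply/eqP => /(congr1 (fun x => coefs x (m + n.+1))); rewrite coef_tnM.
rewrite ltnNge leq_addr /= addKn => /eqP; rewrite -subr_eq0 addrAC subrr add0r.
by rewrite oner_eq0.
Qed.

Lemma avoid_roots (I : countType) (Q : I -> {poly D}) m : exists2 s : D,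
  ps_res s = 1 & forall i, Q i != 0 -> (Q i).[t ^+ m * s] != 0.
Proof.
have rsP i : exists rs : seq D, Q i != 0 -> forall z, root (Q i) z -> z \in rs.
  by have [->|/poly_roots[rs]] := eqVneq (Q i) 0; [exists [::] | exists rs].
pose rs i := sval (cid (rsP i)).
(* One sequence through all the lists [rs i], coded by [i] and a position; codes of nothing give
   0. *)
pose r n := if unpickle n is Some (i, j) then nth 0 (rs i) j else 0.
have [s s1 sP] := avoid_seq r m; exists s => // i Qi; apply/negP => root_i.
have z_rs : t ^+ m * s \in rs i := svalP (cid (rsP i)) Qi _ root_i.
have /negP := sP (pickle (i, index (t ^+ m * s) (rs i))); apply.
by rewrite /r pickleK nth_index.
Qed.

End Generic.

(** * Representing the double *)

Section DoubleMatrices.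

Local Notation D := (pseries 'F_3).
Local Notation t := (ps_t 'F_3).
Local Notation v := (@ps_val 'F_3).
Local Notation res := (@ps_res 'F_3).
Local Notation wm := (wmat gmat).
Local Notation word := (seq (bool * bool)).
Local Notation dword := (seq ((bool * bool) * bool)).

Variable z : D.
Hypothesis z0 : z != 0.

Definition dmat (x : bool * bool) : mat2 D :=
  if x.1 then mmul (mmul (mdiag 1 z) (gmat x.2)) (mdiag z 1) else gmat x.2.

Lemma dmat1 b : dmat (true, b) = mmul (mmul (mdiag 1 z) (gmat b)) (mdiag z 1).
Proof. by []. Qed.

Notation wd := (wmat dmat).

Lemma mdiag_z_det : mdet (mdiag 1 z) != 0.
Proof. by rewrite mdet_diag mul1r. Qed.

Lemma dmat_det x : mdet (dmat x) != 0.
Proof.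
rewrite /dmat; case: x.1; rewrite ?gmat_det //.
by rewrite !mdetM !mdet_diag mul1r mulr1 !mulf_neq0 ?gmat_det.
Qed.

Lemma wd_neq0 x : mdet (wd x) != 0.
Proof. exact/wmat_det/dmat_det. Qed.

Lemma wd_side0 u : wd (side false u) = wm u.
Proof. by elim: u => [|[x b] u IHu] //; rewrite [side _ _]/= !wmat_cons IHu. Qed.

Definition twist (M : mat2 D) : mat2 D := mmul (mmul (mdiag 1 z) M) (madj (mdiag 1 z)).

Lemma twistM M N : mprop (mmul (twist M) (twist N)) (twist (mmul M N)).
Proof.
rewrite /twist -!mmulA (mmulA (madj _) (mdiag 1 z)) madj_mul mscalel mmul1 !mscaler.
exact/mprop_scale/mdiag_z_det.
Qed.

Lemma wd_side1 u : mprop (wd (side true u)) (twist (wm u)).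
Proof.
elim: u => [|[x b] u IHu].
  rewrite /twist mmulr1 mmul_adj; exact/mprop_sym/mprop_scale/mdiag_z_det.
rewrite [side _ _]/= !wmat_cons; apply: mprop_trans (twistM _ _).
apply: mprop_mul IHu.
have -> : lmat dmat (true, x, b) = twist (lmat gmat (x, b)).
  have lmatV (Y : choiceType) (f : Y -> mat2 D) y : lmat f (y, true) = madj (f y) by [].
  rewrite /twist madj_diag; case: b; last by [].
  by rewrite !lmatV dmat1 !madjM !madj_diag mmulA.
exact: mprop_refl.
Qed.

Lemma twist_diag x y : mprop (twist (mdiag x y)) (mdiag x y).
Proof.
have -> : twist (mdiag x y) = mscale z (mdiag x y).
  by rewrite /twist madj_diag !mmul_diag mscale_diag mul1r mulr1 mulrC.
exact: mprop_scale.
Qed.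

Lemma wd_double_word : mprop (wd double_word) (m1 D).
Proof.
have [k k0 e] := wm_comm.
rewrite wmat_cat wmat_inv wd_side0.
apply: (@mprop_trans _ (mmul (wm comm_word) (madj (wm comm_word)))); last first.
  exact/wmat_mulV/gmat_det.
apply: mprop_mul (mprop_refl _) _.
apply: mprop_adj; apply: mprop_trans (wd_side1 _) _; rewrite e.
have -> : twist (mscale k (mdiag 1 (t ^+ 4))) = mscale k (twist (mdiag 1 (t ^+ 4))).
  by rewrite /twist mscaler mscalel.
apply: mprop_trans (mprop_scale _ k0) (mprop_trans (twist_diag _ _) _).
exact/mprop_sym/mprop_scale.
Qed.

Lemma wd_deq x y : deq x y -> mprop (wd x) (wd y).
Proof.
by move=> xy; apply: (wmat_word_eq dmat_det _ xy) => _ ->; apply: wd_double_word.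
Qed.

Lemma wd_pair_word ps : mprop (wd (pair_word ps)) (pair_mat z [seq (wm p.1, wm p.2) | p <- ps]).
Proof.
elim: ps => [|p ps IHps]; first exact: mprop_refl.
rewrite /pair_word [flatten _]/= -/(pair_word ps) !wmat_cat wd_side0.
rewrite [map _ _]/= pair_mat_cons; apply: mprop_mul IHps.
apply: mprop_trans (mprop_mul (mprop_refl _) (wd_side1 _)) _.
by rewrite /twist madj_diag -!mmulA; apply: mprop_refl.
Qed.

Lemma ncomm_twisted u w : ~ is_comm u -> ~ is_comm w -> twisted_pair (wm u, wm w).
Proof.
have dw := wmat_det gmat_det; move=> nu nw; split=> /=.
  apply/eqP => e; apply: nu; case E: (wm u) e => [[[a b] c] d] /= c0.
  (* With the diagonal valuations themselves as indices the second clause of [tri_val] is trivial,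
     so being triangular suffices. *)
  by apply: (@tri_val_comm false _ (v a) (v d)); rewrite E; split=> //; rewrite addnC.
apply/eqP => e; apply: nw; case E: (wm w) e => [[[a b] c] d] /= b0.
by apply: (@tri_val_comm true _ (v a) (v d)); rewrite E; split=> //; rewrite addnC.
Qed.

Lemma mscalar_nhyp (M : mat2 D) : mdet M != 0 -> mscalar M -> ~ hyperbolic_mat M.
Proof.
case: M => [[[a b] c] d] dM [b0 c0 ad]; subst b c d.
have [a0 _] := @tri_diag_neq0 true _ _ _ _ dM erefl.
by apply: triangular_nhyp; rewrite ?a0 //= eqxx.
Qed.

Lemma reduced_twisted ps : reduced_pairs ps ->
  forall p, p \in [seq (wm p.1, wm p.2) | p <- ps] -> twisted_pair p.
Proof. by move=> red p /mapP[q /red[q1 q2] ->]; apply: ncomm_twisted. Qed.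

Lemma hyp_side s u : hyperbolic_mat (wm u) -> hyperbolic_mat (wd (side s u)).
Proof.
case: s; last by rewrite wd_side0.
move=> hu; have dw := wmat_det gmat_det u.
have dt : mdet (twist (wm u)) != 0.
  by rewrite /twist !mdetM mdet_adj !mulf_neq0 ?mdiag_z_det.
apply: hyp_prop dt (mprop_sym (wd_side1 u)) _.
exact: hyp_conj mdiag_z_det dw hu.
Qed.

Lemma wd_conj x y g : deq x (g ++ y ++ word_inv g) ->
  mprop (wd x) (mmul (mmul (wd g) (wd y)) (madj (wd g))).
Proof. by move/wd_deq; rewrite !wmat_cat wmat_inv mmulA. Qed.

Lemma wd_faithful x :
    (forall ps, ps != [::] -> reduced_pairs ps ->
      (pair_gap [seq (wm p.1, wm p.2) | p <- ps]).[z] != 0) ->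
  mscalar (wd x) -> deq x [::].
Proof.
move=> gap sx; have [y [g xy] ny] := normal_form x.
have {sx}sy : mscalar (wd y).
  exact: mscalar_conj (wd_neq0 g) (mscalar_prop (wd_conj xy) sx).
case: ny => [y1|[s [u [yE hu]]]|[ps [nps yE red]]].
- by apply: word_eq_trans xy _; rewrite y1; apply: word_mulV.
- by case: (mscalar_nhyp (wd_neq0 y) sy); rewrite yE; apply: hyp_side.
- case: (pair_mat_nscalar (gap _ nps red)).
  by apply: mscalar_prop (wd_pair_word ps) _; rewrite -yE.
Qed.

Lemma wd_hyp_conj x y : dconj x y -> hyperbolic_mat (wd y) -> hyperbolic_mat (wd x).
Proof.
case=> g /wd_conj xy hy.
apply: hyp_prop (mprop_sym xy) (hyp_conj (wd_neq0 g) (wd_neq0 y) hy).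
by rewrite !mdetM mdet_adj !mulf_neq0 ?wd_neq0.
Qed.

End DoubleMatrices.

(** * Choice of the twisting parameter *)

Section DoubleRepresentation.

Local Notation D := (pseries 'F_3).
Local Notation t := (ps_t 'F_3).

(** Modulo z the trace is a fixed nonzero y, and the determinant is divisible by z^2, so v(z) > v(y)
    suffices, uniformly in [s]. The witness gives v(z) = 4 (v(y) + 1). *)
Lemma hyp_pair_mat ps : ps != [::] -> reduced_pairs ps -> exists n, forall s : D,
  ps_res s = 1 -> hyperbolic_mat (wmat (dmat (t ^+ (4 * n) * s)) (pair_word ps)).
Proof.
move=> nps red; set qs := [seq (wmat gmat p.1, wmat gmat p.2) | p <- ps].
have nqs : qs != [::] by rewrite -size_eq0 size_map size_eq0.
have [y y0 yP] := pair_mat_tr nqs (reduced_twisted red).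
exists (ps_val y).+1 => s s1; set z := _ * s.
have s0 : s != 0 by apply: contra_eq_neq s1 => ->; rewrite rmorph0 eq_sym oner_eq0.
have z0 : z != 0 by rewrite mulf_neq0 ?expf_neq0 ?ps_t_neq0.
have vz : ps_val z = (4 * (ps_val y).+1)%N.
  rewrite ps_valM ?expf_neq0 ?ps_t_neq0 // ps_valX ?ps_t_neq0 // ps_val_t.
  by rewrite (@ps_res_val _ s) ?s1 ?oner_eq0 // addn0 muln1.
have dP : mdet (pair_mat z qs) != 0.
  by rewrite -(mprop_det (wd_pair_word z0 ps)) wd_neq0.
apply: (hyp_prop dP) (mprop_sym (wd_pair_word z0 ps)) _.
have [k tE] := yP z; have [l dE] := mdet_pair_mat z nqs.
have [yv yi] := ps_valP y0.
have zk i : (i <= ps_val y)%N -> coefs (z * k) i = 0.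
  by move=> i_le; rewrite /z -mulrA coef_tnM (leq_ltn_trans i_le) //; lia.
have coefsD i : coefs (y + z * k) i = coefs y i + coefs (z * k) i by [].
have vT : ps_val (mtr (pair_mat z qs)) = ps_val y.
  apply: ps_val_eq => [|i lt]; rewrite tE coefsD zk ?addr0 //; first exact: yi.
  exact: ltnW.
split.
  have e : coefs (y + z * k) (ps_val y) = coefs y (ps_val y).
    by rewrite coefsD zk // addr0.
  by apply: contraNneq yv => T0; rewrite -e -tE T0 [coefs 0 _]mul0rn.
have l0 : l != 0 by apply: contraTneq dP => l0; rewrite dE l0 mulr0 eqxx.
by rewrite vT dE; clearbody z; rewrite !ps_valM ?mulf_neq0 // vz; lia.
Qed.

(** The order of choices matters: [n] depends on [x] alone and works for all [s] of residue 1, which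
    leaves [s] free to avoid the roots of the countably many gap polynomials. *)
Lemma double_rep x : ~ deq x [::] -> exists n (s : D),
  [/\ ps_res s = 1, hyperbolic_mat (wmat (dmat (t ^+ (4 * n) * s)) x)
    & forall y, mscalar (wmat (dmat (t ^+ (4 * n) * s)) y) -> deq y [::]].
Proof.
move=> nx; have [y xy ny] := normal_form x.
have [n yn] : exists n, forall s : D, ps_res s = 1 ->
    hyperbolic_mat (wmat (dmat (t ^+ (4 * n) * s)) y).
  case: ny => [y1|[b [u [-> hu]]]|[ps [nps -> red]]]; last exact: hyp_pair_mat.
    case: nx; case: xy => g xy; apply: word_eq_trans xy _; rewrite y1.
    exact: word_mulV.
  exists 0%N => s s1; apply: hyp_side hu.
  by rewrite muln0 mul1r; apply: contra_eq_neq s1 => ->; rewrite rmorph0 eq_sym oner_eq0.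
have [s s1 sP] := avoid_roots (fun ps : seq (seq (bool * bool) * seq (bool * bool)) =>
  pair_gap [seq (wmat gmat p.1, wmat gmat p.2) | p <- ps]) (4 * n).
have s0 : s != 0 by apply: contra_eq_neq s1 => ->; rewrite rmorph0 eq_sym oner_eq0.
have z0 : t ^+ (4 * n) * s != 0 by rewrite mulf_neq0 ?expf_neq0 ?ps_t_neq0.
exists n, s; split=> // [|w]; first exact: wd_hyp_conj xy (yn s s1).
apply: wd_faithful => // ps nps red; apply/sP/pair_gap_neq0; last exact: reduced_twisted.
by rewrite -size_eq0 size_map size_eq0.
Qed.

End DoubleRepresentation.

(** * The surface group in the double *)

Section PresentationMorphisms.

Local Open Scope group_scope.

Variables (X : choiceType) (R : seq (X * bool) -> Prop) (G : groupType) (f : X -> G).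

Definition letter_value (l : X * bool) : G := if l.2 then (f l.1)^-1 else f l.1.
Definition word_value (w : seq (X * bool)) : G := \prod_(l <- w) letter_value l.

Hypothesis f_rel : forall r, R r -> word_value r = 1.

Lemma word_value_cat u v : word_value (u ++ v) = word_value u * word_value v.
Proof. exact: big_cat. Qed.

Lemma word_value1 l : word_value [:: l] = letter_value l.
Proof. by rewrite /word_value big_seq1. Qed.

Lemma word_value_eq u v : word_eq R u v -> word_value u = word_value v.
Proof.
elim=> {u v} [//|//|u v w _ -> _ -> //|u u' v v' _ e _ e'|x b|r /f_rel->].
- by rewrite !word_value_cat e e'.
- rewrite -cat1s word_value_cat !word_value1 /word_value big_nil /letter_value /=.
  by case: b; rewrite ?mulgV ?mulVg.
- by rewrite /word_value big_nil.
Qed.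

Definition pres_hom (x : presented_group R) : G := word_value (repr x).

Lemma pres_hom_class w : pres_hom (word_class R w) = word_value w.
Proof. exact/word_value_eq/repr_word_class. Qed.

Lemma word_classM u v : word_class R (u ++ v) = (word_class R u * word_class R v)%g.
Proof. by rewrite -pres_mulE. Qed.

Lemma word_classV u : word_class R (word_inv u) = (word_class R u)^-1%g.
Proof. by rewrite -pres_invE. Qed.

Lemma pres_homM x y : pres_hom (x * y) = pres_hom x * pres_hom y.
Proof.
by rewrite -(word_class_repr x) -(word_class_repr y) -word_classM !pres_hom_class
  word_value_cat.
Qed.

Lemma pres_hom1 : pres_hom 1 = 1.
Proof. by rewrite (pres_hom_class [::]) /word_value big_nil. Qed.

Lemma pres_homV x : pres_hom x^-1 = (pres_hom x)^-1.
Proof. by apply/eqP; rewrite -mulg_eq1 -pres_homM mulVg pres_hom1. Qed.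

End PresentationMorphisms.

Section Generators.

Local Open Scope group_scope.

Variables (X : choiceType) (R : seq (X * bool) -> Prop).

Definition gen (x : X) : presented_group R := word_class R [:: (x, false)].

Lemma word_class_letter l : word_class R [:: l] = letter_value gen l.
Proof. by case: l => x []; rewrite /letter_value //= -word_classV. Qed.

Lemma word_class_value w : word_class R w = word_value gen w.
Proof.
elim: w => [|l w IHw]; first by rewrite /word_value big_nil.
by rewrite -cat1s word_classM IHw word_class_letter word_value_cat word_value1.
Qed.

Lemma pres_hom_gen (G : groupType) (f : X -> G) :
    (forall r, R r -> word_value f r = 1) ->
  forall x, pres_hom f (gen x) = f x.
Proof. by move=> fR x; rewrite pres_hom_class // word_value1. Qed.

End Generators.

(** * The map from the surface group to the double *)

Section SurfaceEmbedding.

Local Open Scope group_scope.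

Definition bracket (G : groupType) (x y : G) : G := x * y * x^-1 * y^-1.

Definition double_group : groupType :=
  @presented_group (bool * bool)%type (fun w => w = double_word).

Definition dgen (s b : bool) : double_group := gen _ (s, b).

Local Notation A := (dgen false false).
Local Notation B := (dgen false true).
Local Notation A' := (dgen true false).
Local Notation B' := (dgen true true).

Lemma word_value_side_comm (G : groupType) (f : bool * bool -> G) s :
  word_value f (side s comm_word) = bracket (f (s, false)) (f (s, true)).
Proof.
by rewrite /word_value /= !big_cons big_nil /letter_value /= mulg1 !mulgA.
Qed.

Lemma double_bracket : bracket A' B' = bracket A B.
Proof.
have : word_class _ double_word = 1 :> double_group by apply/word_classP/word_eq_rel.
rewrite /double_word word_classM word_classV => /divg1_eq.
by rewrite !word_class_value !word_value_side_comm.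
Qed.

Variable k : nat.

Local Notation S := (surface_group k.+2).

Definition sgen_a (j : nat) : S := gen _ (inl (inord j)).
Definition sgen_b (j : nat) : S := gen _ (inr (inord j)).

Lemma surface_word_value (G : groupType) (f : 'I_k.+2 + 'I_k.+2 -> G) :
  word_value f (surface_word k.+2) =
  \prod_(j < k.+2) bracket (f (inl (inord j))) (f (inr (inord j))).
Proof.
pose F j := bracket (f (inl (inord j))) (f (inr (inord j))).
rewrite -(big_mkord xpredT F) /index_iota subn0 -val_enum_ord big_map /surface_word.
elim: (enum _) => [|i s IHs]; first by rewrite /word_value !big_nil.
rewrite [flatten _]/= big_cons -IHs /F inord_val /word_value !big_cons.
by rewrite /letter_value /bracket /= !mulgA.
Qed.

Lemma surface_relation : \prod_(j < k.+2) bracket (sgen_a j) (sgen_b j) = 1.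
Proof.
rewrite -(surface_word_value (fun x => gen _ x)) -word_class_value.
by apply/word_classP/word_eq_rel.
Qed.

(** In the cover of degree k + 1 that unwraps a, the first handle is a^(k+1), b, and the others are
    lifts of the handle a', b', one on each sheet, with the two generators swapped because [b', a']
    is the inverse of [a, b]. *)
Definition surface_image (x : 'I_k.+2 + 'I_k.+2) : double_group :=
  match x with
  | inl i => if nat_of_ord i is j.+1 then A ^+ j * B' * A ^- j else A ^+ k.+1
  | inr i => if nat_of_ord i is j.+1 then A ^+ j * A' * A ^- j else B
  end.

(* The image of the relator telescopes: [b', a'] = [a, b]^-1, so the partial  *)
(* products of its conjugates by powers of a are b a^m b^-1 a^-m.             *)
Lemma surface_image_rel : word_value surface_image (surface_word k.+2) = 1.
Proof.
rewrite surface_word_value big_ord_recl /= !inordK //.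
have -> : \prod_(i < k.+1) bracket (surface_image (inl (inord (bump 0 i))))
    (surface_image (inr (inord (bump 0 i)))) =
  \prod_(i < k.+1) (A ^+ i * (bracket A B)^-1 * A ^- i).
  apply: eq_bigr => i _; rewrite /surface_image /bump leq0n add1n inordK; last by have := ltn_ord i.
  rewrite -double_bracket /bracket !invgM !invgK !mulgA.
  by rewrite !mulgVK.
suff tele m : \prod_(i < m) (A ^+ i * (bracket A B)^-1 * A ^- i) = bracket B (A ^+ m).
  by rewrite tele /bracket !mulgA !mulgVK mulgK mulgV.
elim: m => [|m IHm]; first by rewrite big_ord0 /bracket expg0 mulg1 mulgV invg1 mulg1.
by rewrite big_ord_recr /= IHm /bracket expgSr !invgM !invgK !mulgA !mulgVK.
Qed.

Lemma surface_image_ok r : r = surface_word k.+2 -> word_value surface_image r = 1.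
Proof. by move=> ->; apply: surface_image_rel. Qed.

Definition surface_to_double : S -> double_group := pres_hom surface_image.

Lemma surface_to_doubleM x y :
  surface_to_double (x * y) = surface_to_double x * surface_to_double y.
Proof. exact: pres_homM surface_image_ok x y. Qed.

End SurfaceEmbedding.

(** * The cyclic cover *)

Section Cover.

Local Open Scope group_scope.

Variable k : nat.

Local Notation S := (surface_group k.+2).
Local Notation A := (dgen false false).
Local Notation B := (dgen false true).
Local Notation A' := (dgen true false).
Local Notation B' := (dgen true true).

(** The lifts of a carry 1 along a spanning tree of the sheets; only the one that closes up to sheet
    0 carries a generator. *)
Definition cover_a (i : 'I_k.+1) : S := if ordS i == ord0 then sgen_a k 0 else 1.

(** The label of the loop b on sheet [j], forced by lifting the relator of the double sheet by
    sheet. *)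
Fixpoint cover_b (j : nat) : S :=
  if j is j'.+1 then (bracket (sgen_a k j) (sgen_b k j))^-1 * cover_b j'
  else sgen_b k 0.

Definition signed (G : groupType) (b : bool) (x : G) : G := if b then x^-1 else x.

(* The cyclic cover of degree [k.+1] of the genus 2 surface dual to the curve *)
(* b, as a right action on the fibres of a trivialised [S]-bundle over the    *)
(* sheets: its fundamental group is [S].                                      *)
Definition cover_step (s : S * 'I_k.+1) (l : (bool * bool) * bool) : S * 'I_k.+1 :=
  let: (h, i) := s in
  match l.1 with
  | (false, false) => if l.2 then (h * (cover_a (ord_pred i))^-1, ord_pred i)
                      else (h * cover_a i, ordS i)
  | (false, true) => (h * signed l.2 (cover_b i), i)
  | (true, false) => (h * signed l.2 (sgen_b k i.+1), i)
  | (true, true) => (h * signed l.2 (sgen_a k i.+1), i)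
  end.

Lemma signedK (G : groupType) b (x y : G) : y * signed b x * signed (~~ b) x = y.
Proof. by case: b; rewrite /signed /= ?mulgK ?mulgVK. Qed.

Lemma cover_stepK x b s : cover_step (cover_step s (x, b)) (x, ~~ b) = s.
Proof.
case: s x => h i [[] []] /=; rewrite ?signedK //.
by case: b; rewrite /= ?ord_predK ?ordSK ?mulgK ?mulgVK.
Qed.

Lemma cover_b_prod j :
  cover_b j = (\prod_(i < j) bracket (sgen_a k i.+1) (sgen_b k i.+1))^-1 * sgen_b k 0.
Proof.
elim: j => [|j IHj]; first by rewrite big_ord0 invg1 mul1g.
by rewrite [LHS]/= IHj mulgA -invgM big_ord_recr.
Qed.

(** The surface relation is what makes the labels close up after one turn round the cover. *)
Lemma cover_b_last : cover_b k.+1 = sgen_a k 0 * sgen_b k 0 * (sgen_a k 0)^-1.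
Proof.
have e : bracket (sgen_a k 0) (sgen_b k 0) *
    \prod_(i < k.+1) bracket (sgen_a k i.+1) (sgen_b k i.+1) = 1.
  by rewrite -[RHS](surface_relation k) [RHS]big_ord_recl; congr (_ * _).
by rewrite cover_b_prod -(mulg1_eq e) invgK /bracket mulgVK.
Qed.

Lemma ordSP (i : 'I_k.+1) :
  if ordS i == ord0 then i.+1 = k.+1 else ordS i = i.+1 :> nat.
Proof.
have := ltn_ord i; rewrite ltnS leq_eqVlt => /orP[/eqP ik|ik].
  by rewrite (_ : ordS i = ord0) ?eqxx ?ik //; apply: val_inj; rewrite /= ik modnn.
have Si : ordS i = i.+1 :> nat by rewrite /= modn_small.
by case: eqVneq => // S0; rewrite S0 in Si.
Qed.

Lemma cover_conj (i : 'I_k.+1) :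
  cover_a i * cover_b (ordS i) * (cover_a i)^-1 = cover_b i.+1.
Proof.
rewrite /cover_a; have := ordSP i; case: eqVneq => [-> ->|_ ->].
  by rewrite cover_b_last.
by rewrite mul1g invg1 mulg1.
Qed.

Lemma cover_relator r s : r = double_word -> foldl cover_step s r = s.
Proof.
move=> ->; case: s => h i; rewrite /= /signed /= ordSK; congr (_, _).
rewrite -[RHS]mulg1 -!mulgA; congr (h * _); rewrite !mulgA cover_conj /=.
have -> : ((i.+1 %% k.+1 + k.+1).-1 %% k.+1)%N = i := congr1 val (ordSK i).
by rewrite mulgK /bracket !invgM !invgK !mulgA !mulgVK mulgK mulgV.
Qed.

Definition cover_act (s : S * 'I_k.+1) (d : double_group) := foldl cover_step s (repr d).

Lemma cover_act_class s w : cover_act s (word_class _ w) = foldl cover_step s w.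
Proof.
exact: (foldl_word_eq cover_stepK cover_relator (repr_word_class _ w) s).
Qed.

Lemma cover_actM s d e : cover_act s (d * e) = cover_act (cover_act s d) e.
Proof.
rewrite -(word_class_repr d) -(word_class_repr e) -word_classM !cover_act_class.
exact: foldl_cat.
Qed.

Lemma cover_act1 s : cover_act s 1 = s.
Proof. exact: (cover_act_class s [::]). Qed.

Lemma cover_actV s s' d : cover_act s d = s' -> cover_act s' d^-1 = s.
Proof. by move=> <-; rewrite -cover_actM mulgV cover_act1. Qed.

Lemma cover_act_gen s x : cover_act s (gen _ x) = cover_step s (x, false).
Proof. exact: cover_act_class. Qed.

Lemma cover_act_pow h (j : nat) : (j <= k)%N ->
  cover_act (h, ord0) (A ^+ j) = (h, inord j).
Proof.
elim: j => [|j IHj] jk.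
  by rewrite expg0 cover_act1; congr (_, _); apply: val_inj; rewrite /= inordK.
rewrite expgSr cover_actM (IHj (ltnW jk)) cover_act_gen /= /cover_a.
have -> : ordS (inord j : 'I_k.+1) = inord j.+1.
  apply: val_inj; rewrite /= !inordK ?ltnS //; last exact: ltnW.
  by rewrite modn_small.
case: ifPn => [/eqP/(congr1 val)|_]; last by rewrite mulg1.
by rewrite /= inordK.
Qed.

(** The path [surface_image x] returns to sheet 0, having collected the label [gen _ x]. Hence an
    element of S is recovered from its image, which gives injectivity. *)
Lemma cover_act_image h x :
  cover_act (h, ord0) (surface_image x) = (h * gen _ x, ord0).
Proof.
have conj (j : nat) d g : (j <= k)%N ->
    cover_act (h, inord j) d = (h * g, inord j) ->
    cover_act (h, ord0) (A ^+ j * d * A ^- j) = (h * g, ord0).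
  move=> jk dg; rewrite !cover_actM (cover_act_pow _ jk) dg; apply: cover_actV.
  exact: cover_act_pow.
case: x => i; rewrite /surface_image; case E: (nat_of_ord i) => [|j].
- have -> : i = inord 0 by apply: val_inj; rewrite /= inordK.
  rewrite expgSr cover_actM cover_act_pow // cover_act_gen /= /cover_a.
  have -> : ordS (inord k : 'I_k.+1) = ord0.
    by apply: val_inj; rewrite /= inordK // modnn.
  by rewrite eqxx.
- have jk : (j <= k)%N by have := ltn_ord i; rewrite E !ltnS.
  apply: conj => //; rewrite cover_act_gen /= /signed inordK //.
  by rewrite /sgen_a -E inord_val.
- have -> : i = inord 0 by apply: val_inj; rewrite /= inordK.
  by rewrite cover_act_gen.
- have jk : (j <= k)%N by have := ltn_ord i; rewrite E !ltnS.
  apply: conj => //; rewrite cover_act_gen /= /signed inordK //.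
  by rewrite /sgen_b -E inord_val.
Qed.

Lemma cover_act_word h w : cover_act (h, ord0) (word_value (@surface_image k) w) =
  (h * word_class _ w, ord0).
Proof.
elim: w h => [|[x b] w IHw] h.
  by rewrite /word_value big_nil cover_act1 (_ : word_class _ _ = 1) ?mulg1.
rewrite -cat1s word_value_cat word_classM cover_actM word_value1 word_class_letter.
have -> : cover_act (h, ord0) (letter_value (@surface_image k) (x, b)) =
    (h * letter_value (gen _) (x, b), ord0).
  rewrite /letter_value /=; case: b; last exact: cover_act_image.
  by apply: cover_actV; rewrite cover_act_image mulgVK.
by rewrite IHw mulgA.
Qed.

Lemma cover_act_surface (x : S) : cover_act (1, ord0) (surface_to_double x) = (x, ord0).
Proof. by rewrite /surface_to_double /pres_hom cover_act_word mul1g word_class_repr. Qed.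

Lemma surface_to_double_inj (x : S) : surface_to_double x = 1 -> x = 1.
Proof. by move=> x1; have := cover_act_surface x; rewrite x1 cover_act1 => -[]. Qed.

(** Reads a state back in the double; applied to the state reached from [(1, ord0)] it writes every
    element as an image from S times a^i with i <= k. *)
Definition cover_value (s : S * 'I_k.+1) : double_group := surface_to_double s.1 * A ^+ s.2.

Local Notation phi := (@surface_to_double k).

Lemma surface_to_double_gen x : phi (gen _ x) = surface_image x.
Proof. exact: pres_hom_gen (@surface_image_ok k) x. Qed.

Lemma surface_to_double1 : phi 1 = 1.
Proof. exact: pres_hom1 (@surface_image_ok k). Qed.

Lemma surface_to_doubleV x : phi x^-1 = (phi x)^-1.
Proof. exact: pres_homV (@surface_image_ok k) x. Qed.

Lemma phi_a j : (j <= k)%N -> phi (sgen_a k j.+1) = A ^+ j * B' * A ^- j.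
Proof. by move=> jk; rewrite surface_to_double_gen /= inordK. Qed.

Lemma phi_b j : (j <= k)%N -> phi (sgen_b k j.+1) = A ^+ j * A' * A ^- j.
Proof. by move=> jk; rewrite surface_to_double_gen /= inordK. Qed.

Lemma phi_cover_b j : (j <= k)%N -> phi (cover_b j) = A ^+ j * B * A ^- j.
Proof.
elim: j => [|j IHj] jk.
  by rewrite /= surface_to_double_gen /= inordK // expg0 mul1g invg1 mulg1.
have phiM := @surface_to_doubleM k.
rewrite [cover_b _]/= phiM surface_to_doubleV /bracket.
rewrite !phiM !surface_to_doubleV phi_a ?phi_b 1?ltnW // (IHj (ltnW jk)).
have -> : A ^+ j * B' * A ^- j * (A ^+ j * A' * A ^- j) * (A ^+ j * B' * A ^- j)^-1 *
  (A ^+ j * A' * A ^- j)^-1 = A ^+ j * (bracket A' B')^-1 * A ^- j.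
  by rewrite /bracket !invgM !invgK !mulgA !mulgVK.
by rewrite double_bracket /bracket expgSr !invgM !invgK !mulgA !mulgVK.
Qed.

Lemma phi_cover_a (i : 'I_k.+1) : phi (cover_a i) * A ^+ ordS i = A ^+ i.+1.
Proof.
rewrite /cover_a; have := ordSP i; case: eqVneq => [-> ->|_ ->].
  by rewrite expg0 mulg1 surface_to_double_gen /= inordK.
by rewrite surface_to_double1 mul1g.
Qed.

Lemma cover_value_step s l :
  cover_value (cover_step s l) = cover_value s * letter_value (gen _) l.
Proof.
have phiM := @surface_to_doubleM k.
have pos x s' : cover_value (cover_step s' (x, false)) = cover_value s' * gen _ x.
  case: s' => h i; have ik : (i <= k)%N by rewrite -ltnS.
  case: x => [[] []]; rewrite /cover_value /= /signed phiM.
  - by rewrite phi_a // !mulgA mulgVK.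
  - by rewrite phi_b // !mulgA mulgVK.
  - by rewrite phi_cover_b // !mulgA mulgVK.
  rewrite -[(i.+1 %% k.+1)%N]/(nat_of_ord (ordS i)) -mulgA phi_cover_a expgSr.
  by rewrite mulgA.
case: l => x []; last exact: pos.
have := pos x (cover_step s (x, true)); rewrite (cover_stepK x true) => ->.
by rewrite /letter_value /= mulgK.
Qed.

Lemma cover_value_act s d : cover_value (cover_act s d) = cover_value s * d.
Proof.
rewrite -{2}(word_class_repr d) word_class_value /cover_act.
elim: (repr d) s => [|l w IHw] s; first by rewrite /word_value big_nil mulg1.
by rewrite [LHS]IHw cover_value_step /word_value big_cons mulgA.
Qed.

Lemma cover_valueE d : cover_value (cover_act (1, ord0) d) = d.
Proof.
by rewrite cover_value_act /cover_value surface_to_double1 expg0 mulg1 mul1g.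
Qed.

Local Notation C := (bracket A B).

Lemma sheet_comm s : (cover_act s C).2 = s.2.
Proof.
have -> : C = word_class _ (side false comm_word).
  by rewrite word_class_value word_value_side_comm.
by rewrite cover_act_class; case: s => h i; rewrite /= ordSK.
Qed.

Lemma sheet_comm_pow s m : (cover_act s (C ^+ m)).2 = s.2.
Proof.
elim: m => [|m IHm]; first by rewrite expg0 cover_act1.
by rewrite expgSr cover_actM sheet_comm.
Qed.

Lemma sheet_comm_powV s m : (cover_act s (C ^- m)).2 = s.2.
Proof.
rewrite -(sheet_comm_pow (cover_act s (C ^- m)) m) -cover_actM mulVg.
by rewrite cover_act1.
Qed.

Definition sheet_shift m : double_group := C ^+ m * A^-1 * C ^- m * A'.

Lemma sheet_shiftE s m : (cover_act s (sheet_shift m)).2 = ord_pred s.2.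
Proof.
have sheet_b s' : (cover_act s' A').2 = s'.2 by rewrite cover_act_gen; case: s'.
have sheet_a s' : (cover_act s' A^-1).2 = ord_pred s'.2.
  have -> : A^-1 = word_class _ [:: ((false, false), true)].
    by rewrite word_class_letter.
  by rewrite cover_act_class; case: s'.
by rewrite !cover_actM sheet_b sheet_comm_powV sheet_a sheet_comm_pow.
Qed.

(** Each factor [sheet_shift m] lowers the sheet by one, and on sheet 0 [cover_valueE] exhibits an
    image from S. *)
Lemma surface_coset m d : exists j h, d * sheet_shift m ^+ j = phi h.
Proof.
have [n] := ubnP (cover_act (1, ord0) d).2; elim: n d => // n IHn d.
have := cover_valueE d; case E: (cover_act _ d) => [h [[|i] ik]] dE size_d.
  by exists 0%N, h; rewrite expg0 mulg1 -dE /cover_value /= expg0 mulg1.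
have [|j [h' e]] := IHn (d * sheet_shift m).
  rewrite cover_actM sheet_shiftE E /= modnDr modn_small //.
  exact: ltnW.
by exists j.+1, h'; rewrite expgS mulgA.
Qed.

End Cover.

(** * The action *)

(** The support of a fixed point has at most two vertices and is preserved. The square is needed
    because [a] may invert an edge. *)
Lemma elliptic_square_fix (R : realType) (G : groupType) (T : tree)
    (rho : tree_action G T) (a : G) :
  elliptic R rho a -> exists x, rho a (rho a x) = x.
Proof.
case=> p [x [y [t [xy t01 pE]]]] pa.
have p_act u : p (rho a u) = p u.
  by rewrite -(pa (rho a u)) /point_act -actM mulVg act1.
have supp u : p u != 0 -> u = x \/ u = y.
  rewrite pE; have [->|_] := eqVneq u x; first by left.
  have [->|_] := eqVneq u y; first by right.
  by rewrite !mulr0 addr0 eqxx.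
have [u pu] : exists u, p u != 0.
  have [px|] := eqVneq (p x) 0; last by exists x.
  exists y; apply: contra_eq_neq px => py; move: py.
  rewrite !pE !eqxx [y == x]eq_sym; have [_|_] := eqVneq x y; rewrite !mulr1 ?mulr0 ?add0r ?addr0.
    by move=> /eqP; rewrite subrK oner_eq0.
  by move=> ->; rewrite subr0 oner_eq0.
have pau : p (rho a u) != 0 by rewrite p_act.
have paau : p (rho a (rho a u)) != 0 by rewrite !p_act.
have [e|ne] := pselect (rho a u = u); first by exists u; rewrite !e.
(* Of u, a u and a^2 u, all in a support of at most two vertices, two coincide. *)
have [e|e] : rho a (rho a u) = u \/ rho a (rho a u) = rho a u.
- case: (supp _ pu) (supp _ pau) (supp _ paau) => [eu|eu] [eau|eau] [eaau|eaau];
  by [case: ne; rewrite eau eu | left; rewrite eaau eu | right; rewrite eaau eau].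
- by exists u.
- by exists (rho a u); rewrite !e.
Qed.

Section Assembly.

Local Notation D := (pseries 'F_3).
Local Notation t := (ps_t 'F_3).

(** In tr(M^2) = tr(M)^2 - 2 det(M) the first term has the smaller valuation. *)
Lemma hyp_sqr (M : mat2 D) : mdet M != 0 -> hyperbolic_mat M -> hyperbolic_mat (mmul M M).
Proof.
move=> dM [trM lt]; rewrite /hyperbolic_mat mtr_sqr mdetM ps_valM //.
have tr2 : mtr M ^+ 2 != 0 by rewrite expf_neq0.
have vtr2 : ps_val (mtr M ^+ 2) = (ps_val (mtr M)).*2 by rewrite ps_valX // mul2n.
have [nz lo] := ps_valP tr2; have [_ dlo] := ps_valP dM.
pose x := mtr M ^+ 2 - 2%:R * mdet M.
have xE i : (i < ps_val (mdet M))%N -> coefs x i = coefs (mtr M ^+ 2) i.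
  move=> lt_i; rewrite /x mulr_natl mulr2n.
  have -> : coefs (mtr M ^+ 2 - (mdet M + mdet M)) i =
    coefs (mtr M ^+ 2) i - (coefs (mdet M) i + coefs (mdet M) i) by [].
  by rewrite dlo // addr0 subr0.
have vx : ps_val x = (ps_val (mtr M)).*2.
  rewrite -vtr2; apply: ps_val_eq => [|i lt_i]; first by rewrite xE // vtr2.
  by rewrite xE ?lo // (leq_trans lt_i) // vtr2 ltnW.
rewrite -/x vx; split; last by lia.
apply: contraNneq nz => x0; rewrite -xE ?vtr2 // x0.
by rewrite [coefs 0 _]mul0rn.
Qed.

Variables (n : nat) (s : D).
Hypothesis res_s : ps_res s = 1.

Let z := t ^+ (4 * n) * s.

Lemma res1_neq0 : s != 0.
Proof. by apply: contra_eq_neq res_s => ->; rewrite rmorph0 eq_sym oner_eq0. Qed.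

Lemma parameter_neq0 : z != 0.
Proof. by rewrite mulf_neq0 ?res1_neq0 // expf_neq0 // ps_t_neq0. Qed.

Definition double_mat (d : double_group) : mat2 D := wmat (dmat z) (repr d).

Lemma double_mat_det d : mdet (double_mat d) != 0.
Proof. exact: wd_neq0 parameter_neq0 _. Qed.

Lemma double_mat_class w : mprop (double_mat (word_class _ w)) (wmat (dmat z) w).
Proof. exact: (wd_deq parameter_neq0 (repr_word_class _ w)). Qed.

Lemma double_matM d e : mprop (double_mat (d * e)%g) (mmul (double_mat d) (double_mat e)).
Proof.
apply: mprop_trans (double_mat_class _) _.
by rewrite wmat_cat; apply: mprop_refl.
Qed.

Lemma double_matV d : mprop (double_mat (d^-1)%g) (madj (double_mat d)).
Proof.
apply: mprop_trans (double_mat_class _) _.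
by rewrite wmat_inv; apply: mprop_refl.
Qed.

Definition double_act (d : double_group) (x : lattice) : lattice := mact (double_mat d) x.

Lemma double_act1 x : double_act 1%g x = x.
Proof.
rewrite /double_act (mact_prop _ (double_mat_det _) (double_mat_class [::])).
exact: mact1.
Qed.

Lemma double_actM d e x : double_act (d * e)%g x = double_act d (double_act e x).
Proof.
rewrite /double_act (mact_prop _ (double_mat_det _) (double_matM d e)).
by rewrite mactM ?double_mat_det.
Qed.

Definition base_lattice : lattice := lclass (mdiag 1 (t ^+ (4 * n))).

Local Notation A := (dgen false false).
Local Notation C := (bracket A (dgen false true)).

Lemma comm_powE : (C ^+ n)%g = word_class _ (side false (comm_pow false n)).
Proof.
have e : C = word_class _ (side false comm_word).
  by rewrite word_class_value word_value_side_comm.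
rewrite e; elim: n => [|m IHm]; first by rewrite expg0.
by rewrite expgSr IHm -word_classM -side_cat /comm_pow wpowSr.
Qed.

Lemma double_mat_comm_pow : mprop (double_mat (C ^+ n)%g) (mdiag 1 (t ^+ (4 * n))).
Proof.
rewrite comm_powE; apply: mprop_trans (double_mat_class _) _.
by rewrite wd_side0; apply: (wm_comm_pow false n).
Qed.

Lemma shift_identity (R : comNzRingType) (r q : R) :
  mmul (mmul (mmul (madj (1, -1, r, - r ^+ 2)) (mdiag 1 q)) (1, -1, r, - r ^+ 2)) (mdiag q 1) =
  mscale r (q * (q - r), r - r * q, q * (q - 1), 1 - r * q).
Proof. by rewrite /mdiag /=; congr (_, _, _, _); ring. Qed.

(** After removal of the factor t the matrix reduces to the identity at t = 0, since [s] has residue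
    1; so it lies in GL_2(O). *)
Lemma shift_delta :
  delta (mmul (mmul (mmul (madj (gmat false)) (mdiag 1 s)) (gmat false)) (mdiag s 1)) = 0%N.
Proof.
rewrite shift_identity; set U := (_, _, _, _).
have rU : ps_res (mdet U) = 1.
  pose f : {rmorphism D -> 'F_3} := @ps_res 'F_3.
  have fs : f s = 1 by exact: res_s.
  have ft : f t = 0 by exact: ps_res_t.
  rewrite -[ps_res _]/(f _) /U /= !(rmorphB, rmorphM, rmorph1) fs ft.
  by rewrite !(mul0r, subr0, mul1r).
have dU : mdet U != 0 by apply: contra_eq_neq rU => ->; rewrite rmorph0 eq_sym oner_eq0.
by rewrite delta_scale ?ps_t_neq0 // delta_det0 // rU oner_eq0.
Qed.

Lemma double_act_shift : double_act (sheet_shift n) base_lattice = base_lattice.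
Proof.
set c := mdiag 1 (t ^+ (4 * n)).
have T0 : t ^+ (4 * n) != 0 by rewrite expf_neq0 ?ps_t_neq0.
have dc : mdet c != 0 by rewrite mdet_diag mul1r.
set W := mmul (mmul (mmul (madj (gmat false)) (mdiag 1 s)) (gmat false)) (mdiag s 1).
have dW : mdet W != 0.
  by rewrite /W !mdetM mdet_adj !mdet_diag !mul1r !mulr1 !mulf_neq0 ?gmat_det ?res1_neq0.
pose K := mmul (mmul (mmul c (madj (gmat false))) (madj c)) (dmat z (true, false)).
have KE : mprop (double_mat (sheet_shift n)) K.
  apply: mprop_trans (double_matM _ _) _; apply: mprop_mul; last first.
    by apply: mprop_trans (double_mat_class _) _; rewrite wmat1; apply: mprop_refl.
  apply: mprop_trans (double_matM _ _) _; apply: mprop_mul; last first.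
    exact: mprop_trans (double_matV _) (mprop_adj double_mat_comm_pow).
  apply: mprop_trans (double_matM _ _) _; apply: mprop_mul; first exact: double_mat_comm_pow.
  apply: mprop_trans (double_matV _) _; apply: mprop_adj.
  by apply: mprop_trans (double_mat_class _) _; rewrite wmat1; apply: mprop_refl.
(* The powers of t in z = t^(4n) s are absorbed by [c]: adj(c) diag(1, z) is t^(4n) diag(1, s). *)
have KW : mprop (mmul K c) (mmul c W).
  have -> : mmul K c = mscale (t ^+ (4 * n)) (mscale (t ^+ (4 * n)) (mmul c W)).
    have e1 : mmul (madj c) (mdiag 1 z) = mscale (t ^+ (4 * n)) (mdiag 1 s).
      by rewrite /c madj_diag mmul_diag mscale_diag mulr1 mul1r.
    have e2 : mmul (mdiag z 1) c = mscale (t ^+ (4 * n)) (mdiag s 1).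
      by rewrite /c mmul_diag mscale_diag !mulr1 mul1r.
    rewrite /K dmat1 /W -!mmulA e2 (mmulA (madj c)) e1.
    by rewrite !mscaler !mscalel !mscaler.
  by apply: mprop_trans (mprop_scale _ T0) (mprop_scale _ T0).
have dK : mdet K != 0 by rewrite -(mprop_det KE) double_mat_det.
have dKc : mdet (mmul K c) != 0 by rewrite mdetM mulf_neq0.
rewrite /double_act (mact_prop _ (double_mat_det _) KE) mact_class //.
apply/(lclass_eq dKc dc); rewrite (mdist_propl dKc dc KW) -[X in mdist _ X]mmulr1.
rewrite (mdist_mull dc dW m1_det) (mdist_sym dW m1_det) mdist1.
exact: shift_delta.
Qed.

(** The first factor alone is transitive, by [reach] from the standard lattice; c^-n brings the base
    lattice there. *)
Lemma double_transitive y : exists d, y = double_act d base_lattice.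
Proof.
have dc : mdet (mdiag 1 (t ^+ (4 * n))) != 0.
  by rewrite mdet_diag mul1r expf_neq0 ?ps_t_neq0.
have cE : base_lattice = double_act (C ^+ n)%g (lclass (m1 D)).
  rewrite /double_act (mact_prop _ (double_mat_det _) double_mat_comm_pow).
  by rewrite (mact_class dc m1_det) mmulr1.
have [w _ wy] := reach m1_det (lmatrix_det y) erefl; rewrite mmul1 in wy.
exists (word_class _ (side false w) * C ^- n)%g.
rewrite cE double_actM -(double_actM (C ^- n)%g) mulVg double_act1.
rewrite /double_act (mact_prop _ (double_mat_det _) (double_mat_class _)) wd_side0.
have dw := wmat_det gmat_det w.
rewrite (mact_class dw m1_det) mmulr1 -[LHS]lclassK.
exact/esym/(lclass_eq dw (lmatrix_det y)).
Qed.

Variable k : nat.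

Local Notation S := (surface_group k.+2).
Local Notation phi := (@surface_to_double k).

Lemma surface_act1 (x : lattice_tree) : double_act (phi 1%g) x = x.
Proof. by rewrite surface_to_double1 double_act1. Qed.

Lemma surface_actM (a b : S) (x : lattice_tree) :
  double_act (phi (a * b)%g) x = double_act (phi a) (double_act (phi b) x).
Proof. by rewrite surface_to_doubleM double_actM. Qed.

Lemma surface_act_adj (a : S) (x y : lattice_tree) :
  adj (double_act (phi a) x : lattice_tree) (double_act (phi a) y) = adj x y.
Proof. exact: mact_adj (double_mat_det _). Qed.

Definition surface_action : tree_action S lattice_tree :=
  TreeAction surface_act1 surface_actM surface_act_adj.

(** Up to powers of [sheet_shift n] on the right, which fix the base lattice, every element of the
    double comes from S. *)
Lemma surface_transitive (y : lattice) : exists h, y = double_act (phi h) base_lattice.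
Proof.
have [d ->] := double_transitive y; have [j [h dh]] := surface_coset k n d.
exists h; rewrite -dh double_actM; congr double_act.
elim: j {dh} => [|j IHj]; first by rewrite expg0 double_act1.
by rewrite expgS double_actM -IHj double_act_shift.
Qed.

Lemma surface_action_minimal : minimal_action surface_action.
Proof.
move=> Z _ [x Zx] ZG y.
have [h xE] := surface_transitive x; have [h' ->] := surface_transitive y.
have := ZG (h' * h^-1)%g _ Zx; rewrite xE /=.
by rewrite -double_actM -surface_to_doubleM mulgVK.
Qed.

Lemma surface_action_faithful :
  (forall w, mscalar (wmat (dmat z) w) -> deq w [::]) -> faithful_action surface_action.
Proof.
move=> scal a fix_a; apply: surface_to_double_inj.
have /scal/word_classP := mact_faithful (double_mat_det (phi a)) fix_a.
by rewrite word_class_repr.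
Qed.

(** An elliptic element has a square fixing a vertex, but the square of a hyperbolic matrix is
    hyperbolic. *)
Lemma surface_action_hyperbolic (R : realType) (a : S) :
  hyperbolic_mat (double_mat (phi a)) -> hyperbolic R surface_action a.
Proof.
have dM := double_mat_det (phi a); move=> hyp_a /elliptic_square_fix[x].
rewrite /= /double_act -(mactM _ dM dM) => fix_x.
apply: (mact_fix _ fix_x); first by rewrite mdetM mulf_neq0.
exact: hyp_sqr.
Qed.

End Assembly.

Local Close Scope ring_scope.

Theorem corollary8p6 (R : realType) (g : nat) (hg : 2 <= g)
    (gamma : surface_group g) (hgamma : gamma <> 1%g) :
  exists (T : tree) (rho : tree_action (surface_group g) T),
    [/\ locally_finite T, minimal_action rho, faithful_action rho
      & hyperbolic R rho gamma].
Proof.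
case: g hg gamma hgamma => [|[|k]] // _ gamma gamma1.
have [|n [s [s1 hyp_s scal_s]]] := @double_rep (repr (surface_to_double gamma)).
  move=> /word_classP; rewrite word_class_repr => gamma1'.
  exact/gamma1/surface_to_double_inj.
exists lattice_tree, (surface_action n s1 k); split.
- exact: lattice_locally_finite.
- exact: surface_action_minimal.
- exact: surface_action_faithful.
- exact: surface_action_hyperbolic.
Qed.
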